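(* Let $\Bbbk$ be a commutative unital ring that is Noetherian and local, and let $A$ be a unital graded $\Bbbk$-superalgebra, finitely generated and projective as a $\Bbbk$-module, which is semiperfect. If $A$ is split quasi-hereditary, then $A$ is based quasi-hereditary.
   Context: A graded $\Bbbk$-supermodule is a $\Bbbk$-module $V$ with a decomposition $V=\bigoplus_{n\in\mathbb Z,\ \varepsilon\in\mathbb Z/2}V^n_\varepsilon$; an element is homogeneous if it lies in some $V^n_\varepsilon$. A graded $\Bbbk$-superalgebra is a $\Bbbk$-algebra $A$ that is a graded $\Bbbk$-supermodule with $A^n_\varepsilon A^m_\delta\subseteq A^{n+m}_{\varepsilon+\delta}$. Graded $A$-supermodules are $A$-modules $V$ that are graded $\Bbbk$-supermodules with $A^n_\varepsilon V^m_\delta\subseteq V^{n+m}_{\varepsilon+\delta}$. All ideals, subalgebras and submodules are assumed homogeneous. $J(A)$ is the intersection of the annihilators of all graded simple $A$-supermodules. Semiperfect: $A/J(A)$ is left Artinian and homogeneous idempotents lift from $A/J(A)$ to $A$. Upper set: a subset $\Omega$ of a poset $I$ such that $i\in\Omega$, $j\ge i$ imply $j\in\Omega$. Indecomposable split heredity ideal: an ideal $J$ of $A$ such that (1) $A/J$ is projective as a $\Bbbk$-module; (2) $J$ is projective as a left $A$-module; (3) $J^2=J$; (4) $\operatorname{End}_A(J)$ is Morita equivalent to $\Bbbk$. Split quasi-hereditary (for $A$ finitely generated projective over a Noetherian $\Bbbk$): there is a finite poset $I$ and, for every upper set $\Omega\subseteq I$, an ideal $A(\Omega)$ of $A$, with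 $A(\varnothing)=0$ and $A(I)=A$, such that (1) if $\Omega\subseteq\Omega'$ are upper sets then $A(\Omega)\subseteq A(\Omega')$; (2) if $\Omega\subseteq\Omega'$ are upper sets with $|\Omega'\setminus\Omega|=1$, then $A(\Omega')/A(\Omega)$ is an indecomposable split heredity ideal in $A/A(\Omega)$. Based quasi-hereditary: $A$ admits a heredity data, which consists of a finite poset $I$ and finite sets $X=\bigsqcup_{i\in I}X(i)$, $Y=\bigsqcup_{i\in I}Y(i)$ of non-zero homogeneous elements of $A$ with distinguished initial elements $e_i\in X(i)\cap Y(i)$ for each $i\in I$. Put $Z(i)=X(i)\times Y(i)$, $Z=\bigsqcup_{i\in I}Z(i)$, and $A^{>i}=\operatorname{span}_\Bbbk\{xy\mid (x,y)\in Z(j),\ j>i\}$. The axioms are: (a) $B=\{xy\mid (x,y)\in Z\}$ is a $\Bbbk$-basis of $A$ (the products for distinct pairs in $Z$ being distinct); (b) for all $i\in I$, $x\in X(i)$, $y\in Y(i)$, $a\in A$ we have $ax\equiv\sum_{x'\in X(i)}l^x_{x'}(a)x' \pmod{A^{>i}}$ and $ya\equiv\sum_{y'\in Y(i)}r^y_{y'}(a)y'\pmod{A^{>i}}$ for some $l^x_{x'}(a),r^y_{y'}(a)\in\Bbbk$; (c) for all $i\in I$, $x\in X(i)$, $y\in Y(i)$: $xe_i=x$, $e_ix=\delta_{x,e_i}x$, $e_iy=y$, $ye_i=\delta_{y,e_i}y$; and for all $x\in X$, $y\in Y$, $j\in I$: $e_jx\in\{x,0\}$ and $ye_j\in\{y,0\}$.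 *)

(* Defs.v *)
From HB Require Import structures.
From mathcomp Require Import all_boot all_order all_algebra.
From mathcomp Require Import generic_quotient ring_quotient.
From mathcomp Require Import finmap boolp.

Set Implicit Arguments.
Unset Strict Implicit.
Unset Printing Implicit Defensive.

Import Order.TTheory GRing.Theory.
Local Open Scope ring_scope.
Local Open Scope quotient_scope.

(* MathComp's [algType] excludes the zero algebra, which occurs here (as a     *)
(* quotient, and as [A] itself with the empty poset).  A k-algebra is thus     *)
(* given as a possibly zero ring with a central ring morphism from k.          *)
HB.mixin Record PzRing_isPzAlgebra (k : comNzRingType) A of GRing.PzRing A := {
  alg_map : {rmorphism k -> A};
  alg_mapC : forall (c : k) (a : A), alg_map c * a = a * alg_map c
}.

#[short(type="pzAlgType")]
HB.structure Definition PzAlgebra (k : comNzRingType) :=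
  { A of GRing.PzRing A & PzRing_isPzAlgebra k A }.

HB.instance Definition _ (k : comNzRingType) :=
  @PzRing_isPzAlgebra.Build k k^o (idfun : {rmorphism k -> k})
    (fun c a => mulrC c a).

Section Rings.
Variable R : comNzRingType.

Definition comm_ideal (m : R -> Prop) : Prop :=
  m 0 /\ (forall a x y, m x -> m y -> m (a * x + y)).

Definition noetherian : Prop :=
  forall m : nat -> R -> Prop,
    (forall n, comm_ideal (m n)) ->
    (forall n x, m n x -> m n.+1 x) ->
    exists N, forall n, (N <= n)%N -> forall x, m n x <-> m N x.

Definition maximal_ideal (m : R -> Prop) : Prop :=
  [/\ comm_ideal m, ~ m 1 &
      forall m', comm_ideal m' -> ~ m' 1 -> (forall x, m x -> m' x) ->
        forall x, m' x -> m x].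

Definition local_ring : Prop := exists! m : R -> Prop, maximal_ideal m.
End Rings.

Section Modules.
Variables (R : pzRingType) (P : lmodType R).

Definition finitely_generated : Prop :=
  exists n (g : 'I_n -> P), forall v, exists c : 'I_n -> R,
    v = \sum_(i < n) c i *: g i.

Definition projective : Prop :=
  forall (M N : lmodType R) (g : {linear M -> N}) (f : {linear P -> N}),
    (forall y, exists x, g x = y) ->
    exists h : {linear P -> M}, forall p, g (h p) = f p.
End Modules.

Section RestrictionOfScalars.
Variables (k : comNzRingType) (A : pzAlgType k) (V : lmodType A).

Definition restr : Type := V.
HB.instance Definition _ := GRing.Zmodule.on restr.

Definition restr_scale (c : k) (v : restr) : restr :=
  (alg_map c : A) *: (v : V).

Lemma restr_scaleA a b v : restr_scale a (restr_scale b v) = restr_scale (a * b) v.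
Proof. by rewrite /restr_scale scalerA rmorphM. Qed.
Lemma restr_scale1 : left_id 1 restr_scale.
Proof. by move=> v; rewrite /restr_scale rmorph1 scale1r. Qed.
Lemma restr_scaleDr : right_distributive restr_scale +%R.
Proof. by move=> c u v; rewrite /restr_scale scalerDr. Qed.
Lemma restr_scaleDl v : {morph restr_scale^~ v : a b / a + b}.
Proof. by move=> a b; rewrite /restr_scale rmorphD scalerDl. Qed.
HB.instance Definition _ := GRing.Zmodule_isLmodule.Build k restr
  restr_scaleA restr_scale1 restr_scaleDr restr_scaleDl.
End RestrictionOfScalars.

HB.mixin Record isTwoSidedIdeal (R : pzRingType) (J : R -> bool) := {
  tsidealMl : forall a x : R, x \in J -> a * x \in J;
  tsidealMr : forall a x : R, x \in J -> x * a \in J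
}.

#[short(type="tsideal")]
HB.structure Definition TwoSidedIdeal (R : pzRingType) :=
  { J of GRing.ZmodClosed R J & isTwoSidedIdeal R J }.

Section QuotientAlgebra.
Variables (k : comNzRingType) (A : pzAlgType k) (J : tsideal A).

Definition quotient : Type := {ideal_quot J}.
HB.instance Definition _ := GRing.Zmodule.on quotient.

Definition qproj (a : A) : quotient := \pi_({ideal_quot J}) a.

Lemma qproj_surj (b : quotient) : exists a, qproj a = b.
Proof. by exists (repr (b : {ideal_quot J})); rewrite /qproj reprK. Qed.

Lemma qprojP (a b : A) : (qproj a = qproj b) <-> (a - b \in J).
Proof.
rewrite Quotient.idealrBE; split => [/eqP //|/eqP //].
Qed.

Lemma qprojB (a b : A) : qproj (a - b) = qproj a - qproj b.
Proof. by rewrite /qproj; exact: (raddfB (\pi_({ideal_quot J}))). Qed.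

Lemma qprojD (a b : A) : qproj (a + b) = qproj a + qproj b.
Proof. by rewrite /qproj; exact: (raddfD (\pi_({ideal_quot J}))). Qed.

Definition qrepr (b : quotient) : A := repr (b : {ideal_quot J}).
Lemma qreprK b : qproj (qrepr b) = b.
Proof. exact: reprK. Qed.

Definition qone : quotient := qproj 1.
Definition qmul (x y : quotient) : quotient := qproj (qrepr x * qrepr y).

Lemma qprojM a b : qproj (a * b) = qmul (qproj a) (qproj b).
Proof.
apply/qprojP.
have /qprojP ha := esym (qreprK (qproj a)).
have /qprojP hb := esym (qreprK (qproj b)).
rewrite (_ : _ - _ = a * (b - qrepr (qproj b))
    + (a - qrepr (qproj a)) * qrepr (qproj b)); last first.
  by rewrite mulrBr mulrBl addrA addrNK.
by apply: rpredD; [exact: tsidealMl | exact: tsidealMr].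
Qed.

Lemma qmulA : associative qmul.
Proof.
move=> x y z; rewrite -[x]qreprK -[y]qreprK -[z]qreprK.
by rewrite -!qprojM mulrA.
Qed.
Lemma qmul1 : left_id qone qmul.
Proof. by move=> x; rewrite -[x]qreprK -qprojM mul1r. Qed.
Lemma q1mul : right_id qone qmul.
Proof. by move=> x; rewrite -[x]qreprK -qprojM mulr1. Qed.
Lemma qmulDl : left_distributive qmul +%R.
Proof.
move=> x y z; rewrite -[x]qreprK -[y]qreprK -[z]qreprK.
by rewrite -qprojD -!qprojM mulrDl qprojD.
Qed.
Lemma qmulDr : right_distributive qmul +%R.
Proof.
move=> x y z; rewrite -[x]qreprK -[y]qreprK -[z]qreprK.
by rewrite -qprojD -!qprojM mulrDr qprojD.
Qed.
HB.instance Definition _ :=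
  GRing.Zmodule_isPzRing.Build quotient qmulA qmul1 q1mul qmulDl qmulDr.

Definition qalg_map (c : k) : quotient := qproj (alg_map c).
Lemma qalg_map_zmod : zmod_morphism qalg_map.
Proof. by move=> a b; rewrite /qalg_map rmorphB qprojB. Qed.
Lemma qalg_map_monoid : monoid_morphism qalg_map.
Proof.
split=> [|a b]; first by rewrite /qalg_map rmorph1.
by rewrite /qalg_map rmorphM qprojM.
Qed.
HB.instance Definition _ := GRing.isZmodMorphism.Build k quotient qalg_map
  qalg_map_zmod.
HB.instance Definition _ := GRing.isMonoidMorphism.Build k quotient qalg_map
  qalg_map_monoid.
Lemma qalg_mapC (c : k) (x : quotient) : qalg_map c * x = x * qalg_map c.
Proof.
by rewrite -[x]qreprK /qalg_map; apply: etrans (esym (qprojM _ _)) _;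
  rewrite alg_mapC qprojM.
Qed.
HB.instance Definition _ := @PzRing_isPzAlgebra.Build k quotient qalg_map qalg_mapC.

End QuotientAlgebra.

(* The ideal J'/J of A/J, as the image of J' (no inclusion is required).       *)
Section QuotientIdeal.
Variables (k : comNzRingType) (A : pzAlgType k) (J J' : tsideal A).

Definition quotient_ideal_pred : pred (quotient J) :=
  fun b => `[< exists2 a, a \in J' & qproj J a = b >].

Lemma quotient_ideal_zmod : zmod_closed quotient_ideal_pred.
Proof.
split=> [|_ _ /asboolP[a Ja <-] /asboolP[b Jb <-]]; apply/asboolP.
  by exists 0; rewrite ?rpred0// -[0 in LHS](subrr 0) qprojB subrr.
by exists (a - b); rewrite ?rpredB ?qprojB.
Qed.
HB.instance Definition _ :=
  GRing.isZmodClosed.Build (quotient J) quotient_ideal_pred quotient_ideal_zmod.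

Lemma quotient_idealMl (b x : quotient J) :
  x \in quotient_ideal_pred -> b * x \in quotient_ideal_pred.
Proof.
case: (qproj_surj b) => a <- /asboolP[a' Ja' <-]; apply/asboolP.
by exists (a * a'); rewrite ?tsidealMl// qprojM.
Qed.
Lemma quotient_idealMr (b x : quotient J) :
  x \in quotient_ideal_pred -> x * b \in quotient_ideal_pred.
Proof.
case: (qproj_surj b) => a <- /asboolP[a' Ja' <-]; apply/asboolP.
by exists (a' * a); rewrite ?tsidealMr// qprojM.
Qed.
HB.instance Definition _ := isTwoSidedIdeal.Build (quotient J) quotient_ideal_pred
  quotient_idealMl quotient_idealMr.
Definition quotient_ideal : tsideal (quotient J) :=
  TwoSidedIdeal.clone (quotient J) quotient_ideal_pred _.
End QuotientIdeal.

Arguments quotient_ideal {k A} J J'.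

Section IdealModule.
Variables (R : pzRingType) (J : tsideal R).

Definition ideal_pred : pred R^o := fun a => (a : R) \in J.

Lemma ideal_pred_submod : submod_closed ideal_pred.
Proof.
split=> [|a u v Ju Jv]; first exact: (rpred0 J).
rewrite /ideal_pred unfold_in; have Jau : (a * u : R) \in J by apply: tsidealMl.
exact: (rpredD Jau Jv).
Qed.
HB.instance Definition _ :=
  GRing.isSubmodClosed.Build R R^o ideal_pred ideal_pred_submod.

Definition ideal_module : Type := {a : R^o | a \in ideal_pred}.
HB.instance Definition _ := Choice.on ideal_module.
HB.instance Definition _ := SubType.on ideal_module.
HB.instance Definition _ := [SubChoice_isSubLmodule of ideal_module by <:].
End IdealModule.

Section Endomorphisms.
Variables (k : comNzRingType) (A : pzAlgType k) (V : lmodType A).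

Record endo : Type := Endo {
  endo_fun :> V -> V;
  endoP : forall (a : A) u v, endo_fun (a *: u + v) = a *: endo_fun u + endo_fun v
}.

Lemma endo_ext (f g : endo) : f =1 g -> f = g.
Proof.
case: f g => [f fP] [g gP] /= fg; have E : f = g by apply/funext.
by rewrite E in fP *; congr Endo; apply: Prop_irrelevance.
Qed.

HB.instance Definition _ := gen_eqMixin endo.
HB.instance Definition _ := gen_choiceMixin endo.

Lemma endo0 (f : endo) : f 0 = 0.
Proof.
by have := endoP f 1 0 0; rewrite !scale1r addr0 -[LHS]addr0 => /addrI <-.
Qed.
Lemma endoD (f : endo) u v : f (u + v) = f u + f v.
Proof. by have := endoP f 1 u v; rewrite !scale1r. Qed.

Program Definition ezero := @Endo (fun=> 0) _.
Next Obligation. by rewrite scaler0 addr0. Qed.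
Program Definition eopp (f : endo) := @Endo (fun v => - f v) _.
Next Obligation. by rewrite endoP opprD scalerN. Qed.
Program Definition eadd (f g : endo) := @Endo (fun v => f v + g v) _.
Next Obligation. by rewrite !endoP scalerDr addrACA. Qed.
Program Definition eone := @Endo id _.
Program Definition emul (f g : endo) := @Endo (fun v => f (g v)) _.
Next Obligation. by rewrite !endoP. Qed.
Program Definition ealg_map (c : k) :=
  @Endo (fun v => (alg_map c : A) *: v) _.
Next Obligation. by rewrite scalerDr !scalerA alg_mapC. Qed.

Lemma eaddA : associative eadd.
Proof. by move=> f g h; apply: endo_ext => v /=; rewrite addrA. Qed.
Lemma eaddC : commutative eadd.
Proof. by move=> f g; apply: endo_ext => v /=; rewrite addrC. Qed.
Lemma eadd0 : left_id ezero eadd.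
Proof. by move=> f; apply: endo_ext => v /=; rewrite add0r. Qed.
Lemma eaddN : left_inverse ezero eopp eadd.
Proof. by move=> f; apply: endo_ext => v /=; rewrite addNr. Qed.
HB.instance Definition _ := GRing.isZmodule.Build endo eaddA eaddC eadd0 eaddN.

Lemma emulA : associative emul.
Proof. by move=> f g h; apply: endo_ext. Qed.
Lemma emul1 : left_id eone emul.
Proof. by move=> f; apply: endo_ext. Qed.
Lemma e1mul : right_id eone emul.
Proof. by move=> f; apply: endo_ext. Qed.
Lemma emulDl : left_distributive emul +%R.
Proof. by move=> f g h; apply: endo_ext. Qed.
Lemma emulDr : right_distributive emul +%R.
Proof. by move=> f g h; apply: endo_ext => v /=; rewrite endoD. Qed.
HB.instance Definition _ :=
  GRing.Zmodule_isPzRing.Build endo emulA emul1 e1mul emulDl emulDr.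

Lemma endoZ (f : endo) a v : f (a *: v) = a *: f v.
Proof. by have := endoP f a v 0; rewrite !addr0 endo0 addr0. Qed.

Lemma ealg_map_zmod : zmod_morphism ealg_map.
Proof.
by move=> a b; apply: endo_ext => v /=; rewrite rmorphB scalerBl.
Qed.
Lemma ealg_map_monoid : monoid_morphism ealg_map.
Proof.
split=> [|a b]; apply: endo_ext => v /=; first by rewrite rmorph1 scale1r.
by rewrite rmorphM scalerA.
Qed.
HB.instance Definition _ := GRing.isZmodMorphism.Build k endo ealg_map
  ealg_map_zmod.
HB.instance Definition _ := GRing.isMonoidMorphism.Build k endo ealg_map
  ealg_map_monoid.
Lemma ealg_mapC (c : k) (f : endo) : ealg_map c * f = f * ealg_map c.
Proof. by apply: endo_ext => v /=; rewrite endoZ. Qed.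
HB.instance Definition _ := @PzRing_isPzAlgebra.Build k endo ealg_map ealg_mapC.
End Endomorphisms.

(* A degree (n, eps) combines the Z-degree and the parity.                     *)
Definition deg : Type := (int * 'Z_2)%type.
HB.instance Definition _ := GRing.Zmodule.on deg.

Definition pieces (V : Type) : Type := deg -> V -> Prop.

Definition homogeneous (V : Type) (gr : pieces V) (v : V) : Prop :=
  exists d, gr d v.

(* V is the direct sum of the pieces, which are k-submodules.                  *)
Definition graded_supermodule (k : pzRingType) (V : lmodType k)
    (gr : pieces V) : Prop :=
  [/\ forall d, gr d 0,
      forall d c u v, gr d u -> gr d v -> gr d (c *: u + v),
      forall v, exists (s : seq deg) (f : deg -> V),
        (forall d, gr d (f d)) /\ v = \sum_(d <- s) f d &
      forall (s : seq deg) (f : deg -> V), uniq s -> (forall d, gr d (f d)) ->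
        \sum_(d <- s) f d = 0 -> forall d, d \in s -> f d = 0].

Definition homogeneous_subset (V : zmodType) (gr : pieces V) (N : V -> Prop)
    : Prop :=
  forall v, N v -> exists (s : seq deg) (f : deg -> V),
    (forall d, gr d (f d) /\ N (f d)) /\ v = \sum_(d <- s) f d.

Section GradedAlgebra.
Variables (k : comNzRingType) (A : pzAlgType k) (gr : pieces A).

Definition graded_superalgebra : Prop :=
  @graded_supermodule k (restr A^o) gr /\
  (forall d d' a b, gr d a -> gr d' b -> gr (d + d') (a * b)).

Definition graded_Asupermodule (V : lmodType A) (grV : pieces V) : Prop :=
  @graded_supermodule k (restr V) grV /\
  (forall d d' a v, gr d a -> grV d' v -> grV (d + d') (a *: v)).

Definition submodule (V : lmodType A) (N : V -> Prop) : Prop :=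
  N 0 /\ (forall (a : A) u v, N u -> N v -> N (a *: u + v)).

Definition graded_simple (V : lmodType A) (grV : pieces V) : Prop :=
  [/\ graded_Asupermodule grV, exists v : V, v <> 0 &
      forall N : V -> Prop, submodule N -> homogeneous_subset grV N ->
        (forall v, N v -> v = 0) \/ (forall v, N v)].

Definition jacobson_pred : pred A := fun a =>
  `[< forall (V : lmodType A) (grV : pieces V), graded_simple grV ->
        forall v : V, a *: v = 0 >].

Lemma jacobson_zmod : zmod_closed jacobson_pred.
Proof.
split=> [|a b /asboolP Ja /asboolP Jb]; apply/asboolP => V grV sV v.
  exact: scale0r.
by rewrite scalerBl (Ja V grV) ?(Jb V grV) ?subrr.
Qed.
HB.instance Definition _ := GRing.isZmodClosed.Build A jacobson_pred jacobson_zmod.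
Lemma jacobsonMl (a x : A) : x \in jacobson_pred -> a * x \in jacobson_pred.
Proof.
move=> /asboolP Jx; apply/asboolP => V grV sV v.
by rewrite -scalerA (Jx V grV) ?scaler0.
Qed.
Lemma jacobsonMr (a x : A) : x \in jacobson_pred -> x * a \in jacobson_pred.
Proof.
move=> /asboolP Jx; apply/asboolP => V grV sV v.
by rewrite -scalerA (Jx V grV).
Qed.
HB.instance Definition _ := isTwoSidedIdeal.Build A jacobson_pred
  jacobsonMl jacobsonMr.
Definition jacobson : tsideal A := TwoSidedIdeal.clone A jacobson_pred _.

Definition left_artinian : Prop :=
  forall L : nat -> A^o -> Prop,
    (forall n, submodule (L n) /\ homogeneous_subset gr (L n)) ->
    (forall n a, L n.+1 a -> L n a) ->
    exists N, forall n, (N <= n)%N -> forall a, L n a <-> L N a.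

Definition quotient_pieces (J : tsideal A) : pieces (quotient J) :=
  fun d b => exists2 a, gr d a & qproj J a = b.

Definition ideal_pieces (J : tsideal A) : pieces (ideal_module J) :=
  fun d v => gr d (val v : A).

(* The endomorphisms of degree d.  For a finitely generated V they span the    *)
(* whole of [endo V].  No Koszul sign is used: the signed convention twists    *)
(* the product of two odd endomorphisms by -1, which does not affect whether   *)
(* the algebra is Morita equivalent to k.                                      *)
Definition endo_pieces (V : lmodType A) (grV : pieces V) : pieces (endo V) :=
  fun d f => forall d' v, grV d' v -> grV (d + d') (f v).

End GradedAlgebra.

Arguments quotient_pieces {k A} gr J.
Arguments ideal_pieces {k A} gr J.

Definition trivial_pieces (V : zmodType) : pieces V :=
  fun d v => d = 0 \/ v = 0.

Definition semiperfect (k : comNzRingType) (A : pzAlgType k) (gr : pieces A)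
    : Prop :=
  left_artinian (quotient_pieces gr (jacobson gr)) /\
  (forall b : quotient (jacobson gr),
     homogeneous (quotient_pieces gr (jacobson gr)) b -> b * b = b ->
     exists a : A, [/\ homogeneous gr a, a * a = a & qproj (jacobson gr) a = b]).

Section Category.
Variables (k : comNzRingType) (A : pzAlgType k) (gr : pieces A).

Record gsmod : Type := GsMod {
  gs_mod :> lmodType A;
  gs_pieces : pieces gs_mod;
  gs_axiom : graded_Asupermodule gr gs_pieces
}.

Record gshom (M N : gsmod) : Type := GsHom {
  gs_fun :> {linear M -> N};
  gs_funP : forall d v, gs_pieces d v -> gs_pieces d (gs_fun v)
}.

Definition gsid (M : gsmod) : gshom M M :=
  @GsHom M M idfun (fun d v Mv => Mv).
Definition gscomp (L M N : gsmod) (g : gshom M N) (f : gshom L M) : gshom L N :=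
  @GsHom L N (g \o f) (fun d v Lv => gs_funP g (gs_funP f Lv)).

Lemma gsshift_subproof (e : deg) (M : gsmod) :
  graded_Asupermodule gr (fun d (v : M) => gs_pieces (d + e) v).
Proof.
case: M => M grM [[M0 MZ Mspan Mfree] Mmul] /=; split; first split => //.
- by move=> d; apply: MZ.
- move=> v; have [s [f [fP ->]]] := Mspan v.
  exists [seq d - e | d <- s], (fun d => f (d + e)); split=> //.
  by rewrite big_map; apply: eq_bigr => d _; rewrite subrK.
- move=> s f us fP sum0 d ds; rewrite -[d](addrK e).
  apply: (Mfree [seq d + e | d <- s] (fun d => f (d - e))).
  + by rewrite map_inj_uniq // => x y /addIr.
  + by move=> d'; have := fP (d' - e); rewrite subrK.
  + by rewrite big_map -[RHS]sum0; apply: eq_bigr => d' _; rewrite addrK.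
  + exact: map_f.
- by move=> d d' a v ad vd; rewrite -addrA; apply: Mmul.
Qed.

Definition gsshift (e : deg) (M : gsmod) : gsmod :=
  @GsMod M _ (gsshift_subproof e M).
Definition gsshift_hom (e : deg) (M N : gsmod) (f : gshom M N)
    : gshom (gsshift e M) (gsshift e N) :=
  @GsHom (gsshift e M) (gsshift e N) (gs_fun f)
    (fun d v Mv => @gs_funP M N f (d + e) v Mv).
End Category.

Section Functors.
Variable k : comNzRingType.

Record functor (A B : pzAlgType k) (grA : pieces A) (grB : pieces B) : Type :=
  Functor {
    fobj :> gsmod grA -> gsmod grB;
    fmap : forall M N : gsmod grA, gshom M N -> gshom (fobj M) (fobj N);
    fmap_id : forall M v, fmap (gsid M) v = v;
    fmap_comp : forall L M N (g : gshom M N) (f : gshom L M) v,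
      fmap (gscomp g f) v = fmap g (fmap f v);
    fmap_linear : forall (M N : gsmod grA) (c : k) (f g h : gshom M N),
      (forall v, h v = (alg_map c : A) *: f v + g v) ->
      forall v, fmap h v = (alg_map c : B) *: fmap f v + fmap g v
  }.

Lemma fmap_ext (A B : pzAlgType k) (grA : pieces A) (grB : pieces B)
    (F : functor grA grB) (M N : gsmod grA) (f g : gshom M N) :
  f =1 g -> fmap F f =1 fmap F g.
Proof.
move=> fg v; have := @fmap_linear _ _ _ _ F M N 0 f g f.
by rewrite !rmorph0 => ->; rewrite ?scale0r ?add0r // => u; rewrite scale0r add0r.
Qed.

Section Operations.
Variables (A B C : pzAlgType k).
Variables (grA : pieces A) (grB : pieces B) (grC : pieces C).

Program Definition functor_id : functor grA grA :=
  @Functor A A grA grA id (fun M N f => f) _ _ _.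

Program Definition functor_shift (e : deg) : functor grA grA :=
  @Functor A A grA grA (gsshift e) (fun M N f => gsshift_hom e f) _ _ _.

Program Definition functor_comp (G : functor grB grC) (F : functor grA grB)
    : functor grA grC :=
  @Functor A C grA grC (fun M => G (F M)) (fun M N f => fmap G (fmap F f)) _ _ _.
Next Obligation.
transitivity (fmap G (gsid (F M)) v); last exact: fmap_id.
by apply: fmap_ext => u; exact: fmap_id.
Qed.
Next Obligation.
by rewrite -fmap_comp; apply: fmap_ext => u; exact: fmap_comp.
Qed.
Next Obligation.
by apply: fmap_linear => u; exact: fmap_linear.
Qed.

Definition natural_iso (F G : functor grA grB) : Prop :=
  exists (eta : forall M, gshom (F M) (G M)) (theta : forall M, gshom (G M) (F M)),
    [/\ forall M v, theta M (eta M v) = v,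
        forall M v, eta M (theta M v) = v &
        forall M N (f : gshom M N) v, eta N (fmap F f v) = fmap G f (eta M v)].
End Operations.

(* Equivalence of the categories of graded supermodules, k-linear and          *)
(* commuting with the shifts of degree and of parity.  Without the shifts the  *)
(* Clifford superalgebra k[c], c odd and c^2 = 1, would be equivalent to k.    *)
Definition morita_equivalent (A B : pzAlgType k)
    (grA : pieces A) (grB : pieces B) : Prop :=
  exists (F : functor grA grB) (G : functor grB grA),
    [/\ natural_iso (functor_comp G F) (functor_id grA),
        natural_iso (functor_comp F G) (functor_id grB) &
        forall e : deg, natural_iso (functor_comp F (functor_shift grA e))
                                    (functor_comp (functor_shift grB e) F)].
End Functors.

Section SplitQuasiHereditary.
Variables (k : comNzRingType) (A : pzAlgType k) (gr : pieces A).

Definition homogeneous_ideal (J : tsideal A) : Prop :=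
  homogeneous_subset gr (fun a => a \in J).

Definition ideal_square (J : tsideal A) (a : A) : Prop :=
  exists n (u v : 'I_n -> A),
    (forall i, u i \in J /\ v i \in J) /\ a = \sum_(i < n) u i * v i.

Definition indecomposable_split_heredity_ideal (J : tsideal A) : Prop :=
  [/\ homogeneous_ideal J,
      @projective k (restr (quotient J)^o),
      @projective A (ideal_module J),
      forall a, ideal_square J a <-> a \in J &
      morita_equivalent (endo_pieces (ideal_pieces gr J))
                        (@trivial_pieces k^o : pieces k^o)].
End SplitQuasiHereditary.

Definition upper_set (d : Order.disp_t) (I : finPOrderType d) (O : {set I})
    : Prop :=
  forall i j, i \in O -> (i <= j)%O -> j \in O.

(* Only the values of [J] at upper sets matter.                                *)
Definition split_quasi_hereditary (k : comNzRingType) (A : pzAlgType k)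
    (gr : pieces A) : Prop :=
  exists (d : Order.disp_t) (I : finPOrderType d) (J : {set I} -> tsideal A),
    [/\ forall O, upper_set O -> homogeneous_ideal gr (J O),
        forall a, (a \in J set0) = (a == 0),
        forall a, a \in J [set: I],
        forall O O', upper_set O -> upper_set O' -> O \subset O' ->
          forall a, a \in J O -> a \in J O' &
        forall O O', upper_set O -> upper_set O' -> O \subset O' ->
          #|O' :\: O| = 1%N ->
          indecomposable_split_heredity_ideal
            (quotient_pieces gr (J O)) (quotient_ideal (J O) (J O'))].

Section Based.
Variables (k : comNzRingType) (A : pzAlgType k) (gr : pieces A).
Variables (d : Order.disp_t) (I : finPOrderType d).
Variables (X Y : I -> {fset A}) (e : I -> A).

Definition span_above (i : I) (a : A) : Prop :=
  exists c : I -> A -> A -> k,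
    a = \sum_(j : I | (i < j)%O) \sum_(x <- X j) \sum_(y <- Y j)
          alg_map (c j x y) * (x * y).

Record heredity_data : Prop := HeredityData {
  hd_X : forall i x, x \in X i -> x != 0 /\ homogeneous gr x;
  hd_Y : forall i y, y \in Y i -> y != 0 /\ homogeneous gr y;
  hd_Xdisj : forall i j x, x \in X i -> x \in X j -> i = j;
  hd_Ydisj : forall i j y, y \in Y i -> y \in Y j -> i = j;
  hd_e : forall i, e i \in X i /\ e i \in Y i;
  (* the family of the products xy, indexed by the (i, x, y), is a k-basis *)
  hd_span : forall a : A, exists c : I -> A -> A -> k,
    a = \sum_(i : I) \sum_(x <- X i) \sum_(y <- Y i) alg_map (c i x y) * (x * y);
  hd_free : forall c : I -> A -> A -> k,
    \sum_(i : I) \sum_(x <- X i) \sum_(y <- Y i) alg_map (c i x y) * (x * y) = 0 ->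
    forall i x y, x \in X i -> y \in Y i -> c i x y = 0;
  hd_left : forall i x a, x \in X i -> exists l : A -> k,
    span_above i (a * x - \sum_(x' <- X i) alg_map (l x') * x');
  hd_right : forall i y a, y \in Y i -> exists r : A -> k,
    span_above i (y * a - \sum_(y' <- Y i) alg_map (r y') * y');
  hd_xe : forall i x, x \in X i -> x * e i = x;
  hd_ex : forall i x, x \in X i -> e i * x = if x == e i then x else 0;
  hd_ey : forall i y, y \in Y i -> e i * y = y;
  hd_ye : forall i y, y \in Y i -> y * e i = if y == e i then y else 0;
  hd_ejx : forall i j x, x \in X i -> e j * x = x \/ e j * x = 0;
  hd_yej : forall i j y, y \in Y i -> y * e j = y \/ y * e j = 0
}.
End Based.

Definition based_quasi_hereditary (k : comNzRingType) (A : pzAlgType k)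
    (gr : pieces A) : Prop :=
  exists (d : Order.disp_t) (I : finPOrderType d) (X Y : I -> {fset A})
         (e : I -> A), heredity_data gr X Y e.

(* Main.v *)
Require Import Defs.
From HB Require Import structures.
From mathcomp Require Import all_boot all_order all_algebra.
From mathcomp Require Import generic_quotient ring_quotient.
From mathcomp Require Import finmap boolp.
From mathcomp Require classical_sets.

Set Implicit Arguments.
Unset Strict Implicit.
Unset Printing Implicit Defensive.

Import GRing.Theory.
Local Open Scope ring_scope.

(** Split quasi-heredity provides a chain of ideals [A = K 0 > K 1 > .. > K n = 0]
    in which each [K r / K r.+1] is an indecomposable split heredity ideal of
    [A / K r.+1]; since based quasi-heredity leaves the poset free, the chain
    'I_n with its natural order can serve as the index poset, and the span of the
    layers above [r] has to be [K r.+1].  In each layer one needs an idempotent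
    [e] of degree zero that generates it, with [e A e = k e] modulo [K r.+1], such
    that multiplication identifies the layer with the tensor product over [k] of
    [A e] and [e A] modulo [K r.+1].  Bases of these two modules then give the sets
    [X] and [Y] of the layer.

    The idempotents are not lifted along the chain.  Instead semiperfectness is used
    once, to write 1 as a sum of orthogonal idempotents [f t] of degree zero with
    local corners ([local_idempotent_decomposition]), and each layer selects one of
    them.  Orthogonality is thus automatic, and so is the condition that each [e_j]
    fixes or kills the elements of the bases, as soon as these are chosen in Peirce
    components with respect to the [f t].

    For the selection, let [J] be the heredity ideal of the layer in the algebra
    [B = A / K r.+1].  A graded algebra that is Morita equivalent to the local ring
    [k] contains an idempotent [eps] of degree zero that generates it as an ideal and
    has corner [k] ([morita_idempotent]): the module corresponding to [k] has scalar
    endomorphisms and generates, so Nakayama's lemma splits it off the regular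
    module.  For [End J] this gives a summand of [J] with endomorphism ring [k].  As
    [J] is projective, the identity of this summand is a sum of maps that factor
    through the modules [B f t]; one term is a unit because [k] is local, so the
    summand is isomorphic to [B f t] for some [t].  Then [f t] lies in [J] because
    [J = J ^ 2], and it generates [J] because [eps] generates [End J]
    ([heredity_idempotent]).

    The condition that [A / K r] is projective over [k] makes every [K r] a direct
    summand, and graded pieces of Peirce components of [A / K r.+1] are therefore
    finitely generated projective, hence free ([exists_basis_mod]).  The products of
    the two bases span the layer because [f t] generates it, and they are
    independent because [J] is projective ([exists_layer_basis]). *)

(** * Local rings *)

Lemma zorn_above (T : Type) (P : (T -> Prop) -> Prop) (S0 : T -> Prop) :
  P S0 ->
  (forall F : (T -> Prop) -> Prop, (exists S, F S) -> (forall S, F S -> P S) ->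
     (forall S S', F S -> F S' ->
        (forall x, S x -> S' x) \/ (forall x, S' x -> S x)) ->
     P (fun x => exists2 S, F S & S x)) ->
  exists M, [/\ P M, forall x, S0 x -> M x &
    forall S, P S -> (forall x, M x -> S x) -> forall x, S x -> M x].
Proof.
move=> PS0 Pchain; pose U := {S : T -> Prop | P S /\ (forall x, S0 x -> S x)}.
pose R (s t : U) := `[< forall x, sval s x -> sval t x >].
have [] := @classical_sets.ZL_preorder U (exist _ S0 (conj PS0 (fun x h => h))) R.
- by move=> t; apply/asboolP.
- by move=> r s t /asboolP rs /asboolP st; apply/asboolP => x /rs /st.
- move=> F totF; have [[s0 Fs0]|Fn] := pselect (exists s, F s); last first.
    exists (exist _ S0 (conj PS0 (fun x h => h))) => s Fs.
    by case: Fn; exists s.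
  pose F' S := exists2 s : U, F s & sval s = S.
  have PF : P (fun x => exists2 S, F' S & S x).
    apply: Pchain.
    + by exists (sval s0); exists s0.
    + by move=> _ [s Fs <-]; case: (svalP s).
    + move=> _ _ [s Fs <-] [t Ft <-].
      by case: (totF s t Fs Ft) => /asboolP; [left|right].
  have S0F x : S0 x -> exists2 S, F' S & S x.
    move=> S0x; exists (sval s0); first by exists s0.
    by case: (svalP s0) => _; apply.
  have PS0F := conj PF S0F.
  exists (exist (fun S => P S /\ forall x, S0 x -> S x) _ PS0F) => s Fs.
  apply/asboolP => x sx /=.
  by exists (sval s) => //; exists s.
move=> [M [PM S0M]] Mmax; exists M; split => // S PS MS.
have S0S x : S0 x -> S x by move=> /S0M /MS.
have /asboolP := Mmax (exist _ S (conj PS S0S)) (asboolT MS); exact.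
Qed.

Definition isunit (k : comNzRingType) (a : k) : Prop := exists b, b * a = 1.

Definition nonunits_additive (k : comNzRingType) : Prop :=
  forall a b : k, ~ isunit a -> ~ isunit b -> ~ isunit (a + b).

(** A non-unit generates a proper ideal, hence lies in some maximal ideal: the
    unique one. *)
Lemma local_nonunits_additive (k : comNzRingType) :
  local_ring k -> nonunits_additive k.
Proof.
case=> m [[[m0 mlin] m1 _] muniq].
have nonunit_m a : ~ isunit a -> m a.
  move=> na; pose S0 x := exists b, x = b * a.
  pose P (S : k -> Prop) := comm_ideal S /\ ~ S 1.
  have [| |M [[Mid M1] S0M Mmax]] := @zorn_above k P S0.
  - split; first split; first by exists 0; rewrite mul0r.
      move=> c _ _ [b ->] [b' ->]; exists (c * b + b').
      by rewrite mulrDl mulrA.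
    by case=> b E; apply: na; exists b.
  - move=> F [S FS] FP Ftot; split; last first.
      by case=> S' /FP [_ S'1] /S'1.
    split; first by exists S => //; have [[]] := FP _ FS.
    move=> c x y [S1 FS1 S1x] [S2 FS2 S2y].
    have [S3 [FS3 S3x S3y]] : exists S3, [/\ F S3, S3 x & S3 y].
      by case: (Ftot _ _ FS1 FS2) => h; [exists S2|exists S1]; split => //; apply: h.
    by exists S3 => //; have [[_ lin] _] := FP _ FS3; apply: lin.
  have -> : m = M.
    apply: muniq; split => // m' m'id m'1 Mm' x m'x.
    exact: (Mmax m').
  by apply: S0M; exists 1; rewrite mul1r.
move=> a b /nonunit_m ma /nonunit_m mb [c cE]; apply: m1.
have mab : m (a + b) by rewrite -[a]mul1r; exact: mlin.
by rewrite -cE -[_ * _]addr0; exact: mlin.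
Qed.

Section Local.
Variables (k : comNzRingType) (loc : nonunits_additive k).

Lemma nonunit0 : ~ isunit (0 : k).
Proof. by case=> b /eqP; rewrite mulr0 eq_sym oner_eq0. Qed.

Lemma unit1 : isunit (1 : k).
Proof. by exists 1; rewrite mul1r. Qed.

Lemma nonunitMl (a b : k) : ~ isunit b -> ~ isunit (a * b).
Proof. by move=> nb [c cE]; apply: nb; exists (c * a); rewrite -mulrA. Qed.

Lemma unit_1sub (a : k) : ~ isunit a -> isunit (1 - a).
Proof.
move=> na; apply: contrapT => nb.
by apply: (loc na nb); rewrite addrC subrK; apply: unit1.
Qed.

Lemma nonunit_sum (J : Type) (s : seq J) (F : J -> k) :
  (forall j, ~ isunit (F j)) -> ~ isunit (\sum_(j <- s) F j).
Proof.
move=> nF; apply: (big_ind (fun x => ~ isunit x)) => [|x y|j _].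
- exact: nonunit0.
- exact: loc.
- exact: nF.
Qed.

Lemma unit_summand (J : finType) (F : J -> k) :
  \sum_j F j = 1 -> exists j, isunit (F j).
Proof.
move=> F1; apply: contrapT => nF.
have /nonunit_sum : forall j, ~ isunit (F j) by move=> j uj; apply: nF; exists j.
by move=> /(_ (index_enum J)); rewrite F1; apply; apply: unit1.
Qed.

(** Nakayama's lemma in coordinates, by Gaussian elimination of one vector: the
    diagonal entry [1 - N i i] is a unit. *)
Lemma nakayama (V : lmodType k) n (c : 'I_n -> V) (N : 'I_n -> 'I_n -> k) :
  (forall i j, ~ isunit (N i j)) ->
  (forall i, c i = \sum_j N i j *: c j) -> forall i, c i = 0.
Proof.
elim: n c N => [|n IHn] c N nN cE; first by case.
pose w := widen_ord (leqnSn n).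
have [u uE] := unit_1sub (nN ord_max ord_max).
have cmax : c ord_max = \sum_(j < n) (u * N ord_max (w j)) *: c (w j).
  have := cE ord_max; rewrite big_ord_recr /= => /eqP.
  rewrite -subr_eq -[X in X - _]scale1r -scalerBl => /eqP E.
  rewrite -[LHS]scale1r -uE -scalerA E scaler_sumr.
  by apply: eq_bigr => j _; rewrite scalerA.
have cw0 : forall i, c (w i) = 0.
  apply: (IHn _ (fun i j => N (w i) (w j)
            + N (w i) ord_max * u * N ord_max (w j))).
    by move=> i j; apply: loc => //; apply: nonunitMl.
  move=> i; rewrite [LHS]cE big_ord_recr /= cmax scaler_sumr -big_split /=.
  by apply: eq_bigr => j _; rewrite scalerA -scalerDl mulrA.
have cm0 : c ord_max = 0 by rewrite cmax big1 // => j _; rewrite cw0 scaler0.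
move=> i; have [lt_in|] := ltnP i n.
  by rewrite -(cw0 (Ordinal lt_in)); congr c; apply: val_inj.
move=> le_ni; rewrite -cm0; congr c; apply: val_inj => /=.
by apply/eqP; rewrite eqn_leq le_ni -ltnS ltn_ord.
Qed.
End Local.

(** * Finitely generated projective modules *)

Section LinearFun.
Variables (R : pzRingType) (U V : lmodType R) (f : U -> V).
(** The proof is an argument so that the linear structure of the alias can be
    canonical. *)
Definition linear_fun (_ : linear f) : U -> V := f.
HB.instance Definition _ (fl : linear f) :=
  GRing.isLinear.Build R U V _ (linear_fun fl) fl.
End LinearFun.

Lemma projective_dual_basis (R : pzRingType) (P : lmodType R) n (p : 'I_n -> P) :
  projective P -> (forall v, exists b : 'I_n -> R, v = \sum_i b i *: p i) ->
  exists h : 'I_n -> P -> R,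
    (forall i a u v, h i (a *: u + v) = a * h i u + h i v) /\
    forall v, v = \sum_i h i v *: p i.
Proof.
move=> P_proj gen; pose s (r : 'rV[R]_n) : P := \sum_i r 0 i *: p i.
have sl : linear s.
  move=> a u v; rewrite /s scaler_sumr -big_split; apply: eq_bigr => i _.
  by rewrite !mxE /= scalerDl scalerA.
pose sL : {linear 'rV[R]_n -> P} := linear_fun sl.
have [|g gK] := P_proj _ _ sL idfun.
  move=> v; have [b ->] := gen v; exists (\row_i b i).
  by apply: eq_bigr => i _; rewrite mxE.
exists (fun i v => g v 0 i); split=> [i a u v|v]; first by rewrite linearP !mxE.
by rewrite -[LHS](gK v).
Qed.

(** [sigma] is a projection of [P] whose kernel is that of [g]. *)
Lemma projective_splits (R : pzRingType) (P Q : lmodType R) (g : P -> Q) :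
  linear g -> (forall y, exists x, g x = y) -> projective Q ->
  exists sigma : P -> P, [/\ linear sigma, forall v, g (sigma v) = g v &
    forall v, g v = 0 -> sigma v = 0].
Proof.
move=> gl surj Q_proj; pose gL : {linear P -> Q} := linear_fun gl.
have [h hK] := Q_proj _ _ gL idfun surj.
exists (fun v => h (gL v)); split=> [a u v|v|v gv].
- by rewrite !linearP.
- exact: hK.
- by rewrite (_ : gL v = 0) ?linear0.
Qed.

(** * Homogeneous components *)

Lemma morph_sum (V W : nmodType) (f : V -> W) :
  f 0 = 0 -> {morph f : u v / u + v} ->
  forall (J : Type) (s : seq J) (P : pred J) (F : J -> V),
    f (\sum_(j <- s | P j) F j) = \sum_(j <- s | P j) f (F j).
Proof. by move=> f0 fD J s P F; apply: big_morph. Qed.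

Lemma sum_support (J : eqType) (V : nmodType) (F : J -> V) (s s' : seq J) :
  uniq s -> uniq s' -> (forall j, j \notin s -> F j = 0) ->
  (forall j, j \notin s' -> F j = 0) ->
  \sum_(j <- s) F j = \sum_(j <- s') F j.
Proof.
move=> us us' Fs Fs'.
have filt (t t' : seq J) : (forall j, j \notin t' -> F j = 0) ->
    \sum_(j <- t) F j = \sum_(j <- [seq j <- t | j \in t']) F j.
  move=> Ft'; rewrite big_filter [LHS](bigID (mem t')) /=.
  by rewrite [X in _ + X]big1 ?addr0 //.
rewrite (filt s _ Fs') (filt s' _ Fs); apply: perm_big.
apply: uniq_perm; rewrite ?filter_uniq // => j.
by rewrite !mem_filter andbC.
Qed.

(** Collects the repetitions in the list of degrees of a decomposition. *)
Lemma sum_count (J : eqType) (V : nmodType) (F : J -> V) (s : seq J) :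
  \sum_(j <- s) F j = \sum_(j <- undup s) F j *+ count_mem j s.
Proof. by rewrite -big_undup_iterop_count. Qed.

Lemma sum_only (J : eqType) (V : nmodType) (F : J -> V) (s : seq J) (i : J) :
  uniq s -> (forall j, j != i -> F j = 0) -> (i \notin s -> F i = 0) ->
  \sum_(j <- s) F j = F i.
Proof.
move=> us Fne Fout; have [si|/Fout Fi] := boolP (i \in s).
  by rewrite (bigD1_seq i) //= big1 ?addr0.
by rewrite Fi big1 // => j _; have [->|/Fne] := eqVneq j i.
Qed.

(** [c d] is the projection onto the piece of degree [d] of a grading whose
    support lies in the finite set [D]. *)
Record components (V : zmodType) (gr : pieces V) (D : seq deg)
    (c : deg -> V -> V) : Prop := Components {
  comp_in : forall d v, gr d (c d v);
  compD : forall d, {morph c d : u v / u + v};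
  comp_id : forall d v, gr d v -> c d v = v;
  comp_ne : forall d d' v, gr d' v -> d != d' -> c d v = 0;
  comp_out : forall d v, d \notin D -> c d v = 0;
  comp_uniq : uniq D;
  comp_sum : forall v, v = \sum_(d <- D) c d v
}.

Definition supported (V : zmodType) (gr : pieces V) (D : seq deg) : Prop :=
  uniq D /\ forall d v, gr d v -> d \notin D -> v = 0.

Section GradedSupermodule.
Variables (k : pzRingType) (V : lmodType k) (gr : pieces V).
Hypothesis V_gr : graded_supermodule gr.

Lemma gr0 d : gr d 0.
Proof. by case: V_gr. Qed.

Lemma grZ d c v : gr d v -> gr d (c *: v).
Proof.
by case: V_gr => z lin _ _ dv; rewrite -[_ *: _]addr0; apply: lin.
Qed.

Lemma grD d u v : gr d u -> gr d v -> gr d (u + v).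
Proof. by case: V_gr => _ lin _ _ du dv; rewrite -[u]scale1r; apply: lin. Qed.

Lemma grN d v : gr d v -> gr d (- v).
Proof. by rewrite -scaleN1r; apply: grZ. Qed.

Lemma gr_sum d (J : Type) (s : seq J) (P : pred J) (F : J -> V) :
  (forall j, P j -> gr d (F j)) -> gr d (\sum_(j <- s | P j) F j).
Proof. by move=> dF; apply: big_ind => //; [apply: gr0|apply: grD]. Qed.

Lemma exists_components D : supported gr D -> exists c, components gr D c.
Proof.
case=> uD suppD; case: (V_gr) => _ _ span free.
have dec v : exists f : deg -> V, (forall d, gr d (f d)) /\ v = \sum_(d <- D) f d.
  have [s [f [df ->]]] := span v.
  have dg d : gr d (f d *+ count_mem d s).
    by rewrite -scaler_nat; apply: grZ.
  exists (fun d => f d *+ count_mem d s); split => //.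
  rewrite sum_count; apply: sum_support; rewrite ?undup_uniq //.
    by move=> d; rewrite mem_undup => /count_memPn ->.
  by move=> d; apply: suppD.
pose c d v := sval (cid (dec v)) d.
have cin d v : gr d (c d v) by rewrite /c; case: cid => f [df].
have csum v : v = \sum_(d <- D) c d v by rewrite /c; case: cid => f [df].
have cout d v : d \notin D -> c d v = 0 by apply: suppD.
have cuniq v (f : deg -> V) :
    (forall d, gr d (f d)) -> v = \sum_(d <- D) f d -> forall d, c d v = f d.
  move=> df vE d; have [dD|dD] := boolP (d \in D); last first.
    by rewrite cout // (suppD _ _ (df d)).
  apply/eqP; rewrite -subr_eq0; apply/eqP.
  apply: (free D (fun d => c d v - f d)) => //.
    by move=> d'; apply: grD => //; apply: grN.
  by rewrite sumrB -csum -vE subrr.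
have chom d v d' : gr d v -> c d' v = if d' == d then v else 0.
  move=> dv; pose f d' := if d' == d then v else 0.
  rewrite (cuniq v f) // => [d''|]; rewrite /f.
    by case: eqP => [->//|_]; apply: gr0.
  rewrite (sum_only (i := d)) ?eqxx // => [j /negPf -> //|].
  exact: suppD.
exists c; split => //.
- move=> d u v; apply: (cuniq _ (fun d => c d u + c d v)).
    by move=> d'; apply: grD.
  by rewrite big_split /= -!csum.
- by move=> d v dv; rewrite (chom d) // eqxx.
- by move=> d d' v dv /negPf dd'; rewrite (chom d') // dd'.
Qed.
End GradedSupermodule.

(** A finitely generated graded module lives in finitely many degrees: those of
    the components of the generators. *)
Lemma finitely_generated_supported (k : pzRingType) (V : lmodType k)
    (gr : pieces V) :
  graded_supermodule gr -> finitely_generated V -> exists D, supported gr D.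
Proof.
move=> V_gr [n [g gen]]; case: (V_gr) => _ _ span free.
pose sp i := cid (span (g i)); pose s i := sval (sp i).
have dec i : exists f : deg -> V, (forall d, gr d (f d)) /\
    g i = \sum_(d <- s i) f d by rewrite /s; case: (sp i).
pose f i := sval (cid (dec i)).
have df i d : gr d (f i d) by rewrite /f; case: cid => ? [].
have gE i : g i = \sum_(d <- s i) f i d.
  by rewrite [LHS](svalP (cid (dec i))).2.
pose D := undup (flatten [seq s i | i <- enum 'I_n]).
exists D; split=> [|d v dv dD]; first exact: undup_uniq.
have [c vE] := gen v.
pose h d' := \sum_i c i *: (f i d' *+ count_mem d' (s i)).
have {}vE : v = \sum_(d' <- D) h d'.
  rewrite vE exchange_big /=; apply: eq_bigr => i _.
  rewrite gE sum_count scaler_sumr; apply: sum_support.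
  - exact: undup_uniq.
  - exact: undup_uniq.
  - by move=> j; rewrite mem_undup => /count_memPn ->; rewrite scaler0.
  move=> j jD; rewrite (count_memPn _) ?scaler0 //.
  apply: contraNN jD => js; rewrite mem_undup; apply/flattenP.
  by exists (s i) => //; apply: map_f; rewrite mem_enum.
have := free (d :: D) (fun d' => if d' == d then v else - h d').
rewrite /= dD undup_uniq /=; move=> /(_ isT) /(_ _ _ d).
rewrite eqxx inE eqxx; apply => //.
  move=> d'; case: eqP => [->//|_]; apply: grN => //; apply: gr_sum => // i _.
  by rewrite -scaler_nat; do 2! apply: grZ => //.
rewrite big_cons eqxx; apply/eqP; rewrite addrC addr_eq0; apply/eqP.
rewrite [in RHS]vE -sumrN big_seq [RHS]big_seq; apply: eq_bigr => j jD.
by case: eqP dD => // <-; rewrite jD.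
Qed.

Section Components.
Variables (V : zmodType) (gr : pieces V) (D : seq deg) (c : deg -> V -> V).
Hypothesis cP : components gr D c.

Lemma comp0 d : c d 0 = 0.
Proof. by apply: (addrI (c d 0)); rewrite -(compD cP) !addr0. Qed.

Lemma comp_big d (J : Type) (s : seq J) (P : pred J) (F : J -> V) :
  c d (\sum_(j <- s | P j) F j) = \sum_(j <- s | P j) c d (F j).
Proof. by apply: (morph_sum (comp0 d)); apply: (compD cP). Qed.

Lemma comp_homogeneous d d' v : gr d' v -> c d v = if d == d' then v else 0.
Proof.
move=> dv; case: eqP => [->|/eqP ne]; first exact: (comp_id cP).
exact: (comp_ne cP dv).
Qed.

Lemma homogeneous_subset_comp (N : V -> Prop) :
  N 0 -> (forall u v, N u -> N v -> N (u + v)) -> homogeneous_subset gr N ->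
  forall d v, N v -> N (c d v).
Proof.
move=> N0 ND Nhom d v /Nhom[s [f [fP ->]]]; rewrite comp_big.
apply: big_ind => // d' _; have [df Nf] := fP d'.
by rewrite (comp_homogeneous d df); case: eqP.
Qed.

End Components.

Lemma ext_homogeneous (V W : zmodType) (gr : pieces V) D c (f g : V -> W) :
  components gr D c -> {morph f : u v / u + v} -> {morph g : u v / u + v} ->
  (forall d v, gr d v -> f v = g v) -> f =1 g.
Proof.
move=> cP fD gD fg v.
have z (h : V -> W) : {morph h : u v / u + v} -> h 0 = 0.
  by move=> hD; apply: (addrI (h 0)); rewrite -hD !addr0.
rewrite (comp_sum cP v) !morph_sum ?z //; apply: eq_bigr => d _.
exact: (fg d) (comp_in cP _ _).
Qed.

(** Taking components commutes with additive maps of degree [e]; multiplication by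
    homogeneous elements is the main example. *)
Lemma comp_morph (V W : zmodType) (grV : pieces V) (grW : pieces W) DV DW cV cW
    (f : V -> W) (e : deg) :
  components grV DV cV -> components grW DW cW -> {morph f : u v / u + v} ->
  (forall d v, grV d v -> grW (d + e) (f v)) ->
  forall d v, cW (d + e) (f v) = f (cV d v).
Proof.
move=> cVP cWP fD fe d v; move: v; apply: (ext_homogeneous cVP).
- by move=> u v /=; rewrite fD (compD cWP).
- by move=> u v /=; rewrite (compD cVP) fD.
move=> d' v dv /=; rewrite (comp_homogeneous cWP _ (fe _ _ dv)).
rewrite (comp_homogeneous cVP _ dv) (inj_eq (addIr e)).
case: eqP => // _; symmetry.
by apply: (addrI (f 0)); rewrite -fD !addr0.
Qed.

(** * Quotients of graded modules and algebras *)

Section QuotientModule.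
Variables (k : comNzRingType) (A : pzAlgType k) (V : lmodType A).
Variables (N : V -> Prop) (N_sub : submodule N).

Definition submod_pred : pred V := fun v => `[< N v >].

Lemma submod_pred_closed : submod_closed submod_pred.
Proof.
case: N_sub => N0 Nlin; split=> [|a u v /asboolP Nu /asboolP Nv]; apply/asboolP => //.
exact: Nlin.
Qed.
HB.instance Definition _ :=
  GRing.isSubmodClosed.Build A V submod_pred submod_pred_closed.

Definition submod_zmod : zmodClosed V := GRing.ZmodClosed.clone V submod_pred _.
Definition quotmod : Type := {ideal_quot submod_zmod}.
HB.instance Definition _ := GRing.Zmodule.on quotmod.

Definition mproj (v : V) : quotmod := \pi_({ideal_quot submod_zmod})%qT v.

Lemma mproj_surj (b : quotmod) : exists v, mproj v = b.
Proof. by exists (repr (b : {ideal_quot submod_zmod})); rewrite /mproj reprK. Qed.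

Lemma mprojP (u v : V) : mproj u = mproj v <-> N (u - v).
Proof.
split=> [/eqP|Nuv]; first by rewrite /mproj -Quotient.idealrBE => /asboolP.
by apply/eqP; rewrite /mproj -Quotient.idealrBE; apply/asboolP.
Qed.

Lemma mprojD (u v : V) : mproj (u + v) = mproj u + mproj v.
Proof. by rewrite /mproj; exact: (raddfD (\pi_({ideal_quot submod_zmod})%qT)). Qed.

Definition mrepr (b : quotmod) : V := repr (b : {ideal_quot submod_zmod}).
Lemma mreprK b : mproj (mrepr b) = b.
Proof. exact: reprK. Qed.

Definition mscale (a : A) (b : quotmod) : quotmod := mproj (a *: mrepr b).

Lemma mprojZ a v : mproj (a *: v) = mscale a (mproj v).
Proof.
apply/mprojP; rewrite -scalerBr -[_ *: _]addr0; case: N_sub => N0 Nlin.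
by apply: Nlin => //; apply/mprojP; rewrite mreprK.
Qed.

Lemma mscaleA a b v : mscale a (mscale b v) = mscale (a * b) v.
Proof. by rewrite -[v]mreprK -!mprojZ scalerA. Qed.
Lemma mscale1 : left_id 1 mscale.
Proof. by move=> v; rewrite -[v]mreprK -mprojZ scale1r. Qed.
Lemma mscaleDr : right_distributive mscale +%R.
Proof.
move=> a u v; rewrite -[u]mreprK -[v]mreprK.
by rewrite -mprojD -!mprojZ scalerDr mprojD.
Qed.
Lemma mscaleDl v : {morph mscale^~ v : a b / a + b}.
Proof. by move=> a b; rewrite -[v]mreprK -!mprojZ scalerDl mprojD. Qed.
HB.instance Definition _ := GRing.Zmodule_isLmodule.Build A quotmod
  mscaleA mscale1 mscaleDr mscaleDl.

Lemma mproj_linear a u v : mproj (a *: u + v) = a *: mproj u + mproj v.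
Proof. by rewrite mprojD mprojZ. Qed.

Lemma mproj0 : mproj 0 = 0.
Proof. by apply: (addrI (mproj 0)); rewrite -mprojD !addr0. Qed.

Lemma mproj_eq0 v : mproj v = 0 <-> N v.
Proof. by rewrite -mproj0 mprojP subr0. Qed.

Definition quotmod_pieces (grV : pieces V) : pieces quotmod :=
  fun d b => exists2 v, grV d v & mproj v = b.

Lemma quotmod_graded (gr : pieces A) (grV : pieces V) D c :
  graded_Asupermodule gr grV -> components grV D c ->
  (forall d v, N v -> N (c d v)) ->
  graded_Asupermodule gr (quotmod_pieces grV).
Proof.
move=> [V_gr Vmul] cP Nc; split; last first.
  by move=> d d' a _ ad [v dv <-]; exists (a *: v); [apply: Vmul|rewrite mprojZ].
split.
- by move=> d; exists 0; [apply: (gr0 V_gr)|apply: mproj0].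
- move=> d x _ _ [u du <-] [v dv <-]; exists (alg_map x *: u + v).
    by case: V_gr => _ lin _ _; apply: lin.
  exact: mproj_linear.
- move=> b; have [v <-] := mproj_surj b.
  exists D, (fun d => mproj (c d v)); split.
    by move=> d; exists (c d v) => //; apply: (comp_in cP).
  by rewrite [in LHS](comp_sum cP v) (morph_sum mproj0 mprojD).
- move=> s f us fP f0 d ds.
  have h d' : exists v, grV d' v /\ mproj v = f d' by case: (fP d') => v; exists v.
  pose g d' := sval (cid (h d')).
  have gP d' : grV d' (g d') /\ mproj (g d') = f d' by rewrite /g; case: cid.
  have /(Nc d) : N (\sum_(d' <- s) g d').
    apply/mproj_eq0; rewrite (morph_sum mproj0 mprojD) -[RHS]f0.
    by apply: eq_bigr => j _; case: (gP j).
  rewrite (comp_big cP) (sum_only (i := d)) ?ds //; last first.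
    by move=> j jd; rewrite (comp_ne cP (gP j).1) // eq_sym.
  by rewrite (comp_id cP (gP d).1) => /mproj_eq0 <-; case: (gP d).
Qed.
End QuotientModule.

Section GradedAlgebra.
Variables (k : comNzRingType) (A : pzAlgType k) (gr : pieces A).
Hypothesis A_gr : graded_superalgebra gr.

Lemma grM d d' a b : gr d a -> gr d' b -> gr (d + d') (a * b).
Proof. by case: A_gr => _; apply. Qed.

Section WithComponents.
Variables (D : seq deg) (c : deg -> A -> A).
Hypothesis cP : components gr D c.

Lemma compMl e a : gr e a -> forall d b, c (d + e) (a * b) = a * c d b.
Proof.
move=> ea; apply: (comp_morph cP cP) => [u v|d b db]; first exact: mulrDr.
by rewrite addrC; apply: grM.
Qed.

Lemma compMr e a : gr e a -> forall d b, c (d + e) (b * a) = c d b * a.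
Proof.
move=> ea; apply: (comp_morph cP cP) => [u v|d b db]; first exact: mulrDl.
exact: grM.
Qed.

(** The degree-zero component of 1 is a right identity for homogeneous elements,
    hence for all of them, so that it is 1. *)
Lemma gr_one : gr 0 (1 : A).
Proof.
suff E : forall a, a * c 0 1 = a by rewrite -[1]E mul1r; apply: (comp_in cP).
apply: (ext_homogeneous cP) => [u v|u v|d a da] //=; first exact: mulrDl.
by rewrite -(compMl da) add0r mulr1 (comp_id cP).
Qed.

Lemma gr_alg x : gr 0 (alg_map x : A).
Proof.
have h : gr 0 (alg_map x * 1 : A) := grZ A_gr.1 x gr_one.
by rewrite mulr1 in h.
Qed.

Lemma comp_alg d x a : c d (alg_map x * a) = alg_map x * c d a.
Proof. by rewrite -(compMl (gr_alg x)) addr0. Qed.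
End WithComponents.
End GradedAlgebra.

Section GradedQuotient.
Variables (k : comNzRingType) (A : pzAlgType k) (gr : pieces A).
Hypothesis A_gr : graded_superalgebra gr.
Variables (D : seq deg) (c : deg -> A -> A).
Hypothesis cP : components gr D c.
Variable (K : tsideal A).
Hypothesis K_hom : homogeneous_ideal gr K.
Local Notation B := (quotient K).
Local Notation grB := (quotient_pieces gr K).
Local Notation pi := (qproj K).

Lemma qproj0 : pi 0 = 0.
Proof. by apply: (addrI (pi 0)); rewrite -qprojD !addr0. Qed.

Lemma qproj_eq0 a : pi a = 0 <-> a \in K.
Proof. by rewrite -qproj0 qprojP subr0. Qed.

Lemma qproj_mul a b : pi (a * b) = pi a * pi b.
Proof. exact: qprojM. Qed.

Lemma qproj_sum (J : Type) (s : seq J) (P : pred J) (F : J -> A) :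
  pi (\sum_(j <- s | P j) F j) = \sum_(j <- s | P j) pi (F j).
Proof. by apply: (morph_sum qproj0); apply: qprojD. Qed.

Lemma ideal_comp d a : a \in K -> c d a \in K.
Proof.
apply: (homogeneous_subset_comp cP) K_hom _ _; first exact: rpred0.
by move=> u v; apply: rpredD.
Qed.

Lemma quotient_graded : graded_superalgebra grB.
Proof.
split; last first.
  move=> d d' _ _ [a da <-] [b db <-]; exists (a * b); first exact: (grM A_gr).
  exact: qproj_mul.
split.
- by move=> d; exists 0; [apply: (gr0 A_gr.1)|apply: qproj0].
- move=> d x _ _ [u du <-] [v dv <-]; exists (alg_map x * u + v).
    by case: A_gr => -[_ lin _ _] _; apply: lin.
  by rewrite qprojD qproj_mul.
- move=> b; have [a <-] := qproj_surj b.
  exists D, (fun d => pi (c d a)); split.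
    by move=> d; exists (c d a) => //; apply: (comp_in cP).
  by rewrite [in LHS](comp_sum cP a) qproj_sum.
- move=> s f us fP f0 d ds.
  have h d' : exists v, gr d' v /\ pi v = f d' by case: (fP d') => v; exists v.
  pose g d' := sval (cid (h d')).
  have gP d' : gr d' (g d') /\ pi (g d') = f d' by rewrite /g; case: cid.
  have /(ideal_comp d) : \sum_(d' <- s) g d' \in K.
    apply/qproj_eq0; rewrite qproj_sum -[RHS]f0.
    by apply: eq_bigr => j _; case: (gP j).
  rewrite (comp_big cP) (sum_only (i := d)) ?ds //; last first.
    by move=> j jd; rewrite (comp_ne cP (gP j).1) // eq_sym.
  by rewrite (comp_id cP (gP d).1) => /qproj_eq0 <-; case: (gP d).
Qed.

Lemma quotient_supported : supported grB D.
Proof.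
split=> [|d _ [a da <-] dD]; first exact: (comp_uniq cP).
by rewrite -(comp_id cP da) (comp_out cP) ?qproj0.
Qed.
End GradedQuotient.

Section GradedIdeal.
Variables (k : comNzRingType) (A : pzAlgType k) (gr : pieces A).
Hypothesis A_gr : graded_superalgebra gr.
Variables (D : seq deg) (c : deg -> A -> A).
Hypothesis cP : components gr D c.
Variable (K : tsideal A).
Hypothesis K_hom : homogeneous_ideal gr K.
Local Notation V := (ideal_module K).

Lemma ideal_valD (u v : V) : val (u + v) = val u + val v.
Proof. by []. Qed.
Lemma ideal_val0 : val (0 : V) = 0.
Proof. by []. Qed.
Lemma ideal_valZ a (v : V) : val (a *: v) = a * val v.
Proof. by []. Qed.

Lemma ideal_val_sum (J : Type) (s : seq J) (P : pred J) (F : J -> V) :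
  val (\sum_(j <- s | P j) F j) = \sum_(j <- s | P j) val (F j).
Proof. exact: (morph_sum ideal_val0 ideal_valD). Qed.

Definition ideal_elt (a : A) (aK : a \in K) : V := Sub (a : A^o) aK.
Lemma ideal_eltK a (aK : a \in K) : val (ideal_elt aK) = a.
Proof. exact: SubK. Qed.
Lemma ideal_valP (v : V) : (val v : A) \in K.
Proof. exact: (valP v). Qed.

Lemma ideal_graded : graded_Asupermodule gr (ideal_pieces gr K).
Proof.
split; last by move=> d d' a v; apply: (grM A_gr).
split.
- by move=> d; apply: (gr0 A_gr.1).
- by move=> d x u v; case: A_gr => -[_ lin _ _] _; apply: lin.
- move=> v; exists D.
  exists (fun d => ideal_elt (ideal_comp cP K_hom d (ideal_valP v))); split.
    by move=> d; rewrite /ideal_pieces ideal_eltK; apply: (comp_in cP).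
  apply: val_inj; rewrite ideal_val_sum [LHS](comp_sum cP).
  by apply: eq_bigr => d _; rewrite ideal_eltK.
- move=> s f us fP f0 d ds; apply: val_inj; rewrite ideal_val0.
  case: A_gr => -[_ _ _ free] _; apply: (free s (fun d => val (f d))) => //.
  by rewrite -[RHS]ideal_val0 -f0 ideal_val_sum.
Qed.

Lemma ideal_supported : supported (ideal_pieces gr K) D.
Proof.
split=> [|d v dv dD]; first exact: (comp_uniq cP).
by apply: val_inj; rewrite -(comp_id cP dv) (comp_out cP).
Qed.
End GradedIdeal.

(** * The graded radical and primitive idempotents *)

Section Radical.
Variables (k : comNzRingType) (A : pzAlgType k) (gr : pieces A).
Hypothesis A_gr : graded_superalgebra gr.
Variables (D : seq deg) (c : deg -> A -> A).
Hypothesis cP : components gr D c.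
Local Notation J := (jacobson gr).
Local Notation piJ := (qproj (jacobson gr)).

Lemma regular_graded : graded_Asupermodule (V := A^o) gr gr.
Proof. by case: A_gr. Qed.

(** For homogeneous [v] and [w], comparing components in [a *: v = w] isolates a
    single component of [a]. *)
Lemma graded_action_comp (V : lmodType A) (grV : pieces V) d e a v w :
  graded_Asupermodule gr grV -> grV e v -> grV (d + e) w ->
  a *: v = w -> c d a *: v = w.
Proof.
move=> [V_gr Vmul] ev dw avw; case: (V_gr) => _ _ _ free.
pose s := undup (d :: D).
pose f d' := c (d' - e) a *: v - (if d' == d + e then w else 0).
have := free [seq d' + e | d' <- s] f; move=> /(_ _ _ _ (d + e)).
rewrite /f eqxx addrK => h; apply/eqP; rewrite -subr_eq0; apply/eqP.
apply: h.
- by rewrite map_inj_uniq ?undup_uniq //; apply: addIr.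
- move=> d'; apply: (grD V_gr); last first.
    by apply: (grN V_gr); case: eqP => [->//|_]; apply: (gr0 V_gr).
  by rewrite -[X in grV X](subrK e); apply: Vmul => //; apply: (comp_in cP).
- change (\sum_(d' <- [seq d' + e | d' <- s])
     (c (d' - e) a *: v - (if d' == d + e then w else 0)) = 0 :> V).
  rewrite big_map sumrB.
  rewrite [X in _ - X](sum_only (i := d)) ?undup_uniq ?eqxx //; last 2 first.
  + by move=> d' /negPf nd; rewrite (inj_eq (addIr e)) nd.
  + by rewrite mem_undup inE eqxx.
  have aE : a = \sum_(d' <- s) c d' a.
    rewrite [LHS](comp_sum cP); apply: sum_support.
    * exact: (comp_uniq cP).
    * exact: undup_uniq.
    * by move=> d'; apply: (comp_out cP).
    * move=> d'; rewrite mem_undup inE negb_or => /andP[_].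
      exact: (comp_out cP).
  apply/eqP; rewrite subr_eq0 -avw [in X in _ == X]aE scaler_suml.
  by apply/eqP; apply: eq_bigr => d' _; rewrite addrK.
- by apply: map_f; rewrite mem_undup inE eqxx.
Qed.

Lemma jacobson_kills a (V : lmodType A) (grV : pieces V) (v : V) :
  a \in J -> graded_simple gr grV -> a *: v = 0.
Proof. by move=> /asboolP aJ /aJ; apply. Qed.

Lemma jacobson_comp d a : a \in J -> c d a \in J.
Proof.
move=> aJ; apply/asboolP => V grV Vs v; have [V_gr _ _] := Vs.
have [[_ _ span _] _] := V_gr; have [s [f [fP ->]]] := span v.
rewrite scaler_sumr big1 // => e _.
apply: (graded_action_comp V_gr (fP e)); first exact: (gr0 V_gr.1).
exact: jacobson_kills Vs.
Qed.

Definition hlideal (S : A -> Prop) : Prop :=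
  submodule (V := A^o) S /\ forall d a, S a -> S (c d a).

Lemma hlideal0 S : hlideal S -> S 0.
Proof. by case=> -[]. Qed.
Lemma hlidealD S u v : hlideal S -> S u -> S v -> S (u + v).
Proof. by case=> -[_ lin] _ Su Sv; rewrite -[u]mul1r; apply: lin. Qed.
Lemma hlidealMl S a u : hlideal S -> S u -> S (a * u).
Proof. by case=> -[z lin] _ Su; rewrite -[_ * _]addr0; apply: lin. Qed.
Lemma hlidealB S u v : hlideal S -> S u -> S v -> S (u - v).
Proof. by move=> hS Su Sv; apply: hlidealD => //; rewrite -mulN1r; apply: hlidealMl. Qed.

Lemma maximal_hlideal_simple M (M_sub : submodule (V := A^o) M) :
  hlideal M -> ~ M 1 ->
  (forall S, hlideal S -> ~ S 1 -> (forall a, M a -> S a) -> forall a, S a -> M a) ->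
  graded_simple gr (quotmod_pieces (N_sub := M_sub) gr).
Proof.
move=> hM M1 Mmax; split.
- by apply: (quotmod_graded M_sub regular_graded cP); case: hM.
- by exists (mproj M_sub (1 : A^o)) => /mproj_eq0.
move=> N [N0 Nlin] Nhom.
pose S a := N (mproj M_sub (a : A^o)).
have ND u v : N u -> N v -> N (u + v).
  by move=> Nu Nv; rewrite -[u]scale1r; apply: Nlin.
have S_hl : hlideal S.
  split; first split.
  + by rewrite /S mproj0.
  + by move=> a u v Su Sv; rewrite /S mproj_linear; apply: Nlin.
  move=> d a Sa; have [s [f [fP aE]]] := Nhom _ Sa.
  have h d' : exists v : A, gr d' v /\ mproj M_sub (v : A^o) = f d'.
    by case: (fP d') => -[v]; exists v.
  pose g d' := sval (cid (h d')).
  have gP d' : gr d' (g d') /\ mproj M_sub (g d' : A^o) = f d'.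
    by rewrite /g; case: cid.
  have Msub : M (c d (a - \sum_(d' <- s) g d')).
    case: hM => _; apply.
    apply: (mprojP M_sub (a : A^o) (\sum_(d' <- s) (g d' : A^o))).1.
    rewrite aE (morph_sum (mproj0 M_sub) (mprojD M_sub)).
    by apply: eq_bigr => d' _; case: (gP d').
  have cD u v : c d (u - v) = c d u - c d v.
    by apply/eqP; rewrite eq_sym subr_eq -(compD cP) subrK.
  move: Msub; rewrite cD (comp_big cP) => Msub.
  rewrite /S ((mprojP M_sub (c d a : A^o) (\sum_(d' <- s) (c d (g d') : A^o))).2 Msub).
  rewrite (morph_sum (mproj0 M_sub) (mprojD M_sub)).
  apply: big_ind => // d' _.
  rewrite (comp_homogeneous cP _ (gP d').1); case: eqP => _.
    by rewrite (gP d').2; case: (fP d').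
  by rewrite mproj0.
have MS a : M a -> S a by move=> Ma; rewrite /S (_ : mproj _ _ = 0) //; apply/mproj_eq0.
have [S1|S1] := pselect (S 1); [right|left] => v.
  have [a <-] := mproj_surj v.
  by have := hlidealMl a S_hl S1; rewrite mulr1.
have [a <-] := mproj_surj v => Na; apply/mproj_eq0.
exact: (Mmax S).
Qed.

(** Otherwise a maximal homogeneous left ideal [M] contains [1 - x], and [x],
    which annihilates the graded simple module [A / M], lies in [M] as well. *)
Lemma jacobson_left_inverse x : gr 0 x -> x \in J ->
  exists y, gr 0 y /\ y * (1 - x) = 1.
Proof.
move=> x0 xJ; have g1 := gr_one A_gr cP.
have g1x : gr 0 (1 - x) by apply: (grD A_gr.1) => //; apply: (grN A_gr.1).
pose L a := exists b, a = b * (1 - x).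
pose P (S : A -> Prop) := hlideal S /\ ~ S 1.
apply: contrapT => noinv.
have [| |M [[hM M1] LM Mmax]] := @zorn_above A P L.
- split.
    split; first split; first by exists 0; rewrite mul0r.
      move=> a _ _ [b ->] [b' ->]; exists (a * b + b').
      by rewrite mulrDl -mulrA.
    move=> d _ [b ->]; exists (c d b).
    by rewrite -(compMr A_gr cP g1x) addr0.
  case=> b E; apply: noinv; exists (c 0 b); split; first exact: (comp_in cP).
  by rewrite -(compMr A_gr cP g1x) addr0 -E (comp_id cP).
- move=> F [S FS] FP Ftot; split; last first.
    by case=> S' /FP[_ nS1] /nS1.
  split; first split.
  + by exists S => //; apply: hlideal0; case: (FP S FS).
  + move=> a u v [S1 FS1 S1u] [S2 FS2 S2v].
    have [S3 [FS3 S3u S3v]] : exists S3, [/\ F S3, S3 u & S3 v].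
      by case: (Ftot _ _ FS1 FS2) => h; [exists S2|exists S1]; split=> //; apply: h.
    by exists S3 => //; have [[[_ lin] _] _] := FP _ FS3; apply: lin.
  + by move=> d a [S' FS' S'a]; exists S' => //; have [[_ h] _] := FP _ FS'; apply: h.
have M_sub := hM.1.
have Vs := @maximal_hlideal_simple M M_sub hM M1
  (fun S hS S1 => Mmax S (conj hS S1)).
have Mx : M x.
  apply/(mproj_eq0 M_sub); rewrite -[x]mulr1 [LHS](mprojZ M_sub x (1 : A^o)).
  exact: jacobson_kills xJ Vs.
apply: M1; rewrite -(subrK x 1).
apply: (hlidealD hM); first by apply: LM; exists 1; rewrite mul1r.
exact: Mx.
Qed.

(** The left inverse [y = 1 + y * x] is again 1 minus an element of the radical, so
    it has a left inverse itself. *)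
Lemma jacobson_inverse x : gr 0 x -> x \in J ->
  exists y, [/\ gr 0 y, y * (1 - x) = 1 & (1 - x) * y = 1].
Proof.
move=> x0 xJ; have [y [y0 yE]] := jacobson_left_inverse x0 xJ.
have [||z [z0 zE]] := @jacobson_left_inverse (- (y * x)).
- by apply: (grN A_gr.1); rewrite -[X in gr X _]addr0; apply: (grM A_gr).
- by rewrite rpredN; apply: tsidealMl.
have yE' : 1 - - (y * x) = y.
  by rewrite opprK -yE mulrBr mulr1 subrK.
rewrite yE' in zE; exists y; split=> //.
suff <- : z = 1 - x by [].
by rewrite -[LHS]mulr1 -[X in _ * X = _]yE mulrA zE mul1r.
Qed.

Lemma idempotent_jacobson e : gr 0 e -> e * e = e -> e \in J -> e = 0.
Proof.
move=> e0 ee eJ; have [y [_ yE]] := jacobson_left_inverse e0 eJ.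
by rewrite -[e]mul1r -yE -mulrA mulrBl mul1r ee subrr mulr0.
Qed.

(** These correspond to the homogeneous left ideals of [A / J]; with them the
    chain condition on the quotient is an induction principle on ideals of [A]. *)
Definition over_radical (S : A -> Prop) : Prop :=
  hlideal S /\ forall a, a \in J -> S a.

Hypothesis A_semiperfect : semiperfect gr.

Lemma radical_artinian_ind (P : (A -> Prop) -> Prop) :
  (forall S, over_radical S ->
     (forall S', over_radical S' -> (forall a, S' a -> S a) ->
        ~ (forall a, S a -> S' a) -> P S') -> P S) ->
  forall S, over_radical S -> P S.
Proof.
move=> Pind S0 S0r; apply: contrapT => nPS0.
pose T := {S | over_radical S /\ ~ P S}.
have step (s : T) : exists s' : T, (forall a, sval s' a -> sval s a) /\
    ~ (forall a, sval s a -> sval s' a).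
  case: s => S [Sr nPS] /=; apply: contrapT => noS; apply: nPS; apply: Pind => //.
  move=> S' S'r S'S nS; apply: contrapT => nPS'; apply: noS.
  by exists (exist _ S' (conj S'r nPS')).
pose f s := sval (cid (step s)).
have fP s : (forall a, sval (f s) a -> sval s a) /\
    ~ (forall a, sval s a -> sval (f s) a) by rewrite /f; case: cid.
pose L n := iter n f (exist _ S0 (conj S0r nPS0) : T).
have Lr n : over_radical (sval (L n)) by case: (svalP (L n)).
pose L' n (b : (quotient J)^o) := exists2 a, sval (L n) a & piJ a = b.
have [||n /(_ n.+1 (leqnSn n)) Ln] := A_semiperfect.1 L'.
- move=> n; have [[[z lin] hc] _] := Lr n; split; first split.
  + by exists 0 => //; apply: qproj0.
  + move=> b _ _ [u Lu <-] [v Lv <-]; have [a <-] := qproj_surj b.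
    by exists (a * u + v); [apply: lin|rewrite qprojD qproj_mul].
  + move=> _ [a La <-]; exists D, (fun d => piJ (c d a)); split; last first.
      by rewrite [in LHS](comp_sum cP a) qproj_sum.
    move=> d; split; first by exists (c d a) => //; apply: (comp_in cP).
    by exists (c d a) => //; apply: hc.
- by move=> n _ [a La <-]; exists a => //; case: (fP (L n)) => h _; apply: h.
case: (fP (L n)) => _; apply => a La.
have [_ /(_ (ex_intro2 _ _ a La erefl))] := Ln (piJ a).
case=> a' La' /qprojP aa'; have [hL LJ] := Lr n.+1.
rewrite -[a](subKr a'); apply: (hlidealB hL La'); exact: LJ.
Qed.

Definition minimal_over_radical (L : A -> Prop) : Prop :=
  [/\ over_radical L, exists2 a, L a & a \notin J &
      forall S, over_radical S -> (forall a, S a -> L a) ->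
        (exists2 a, S a & a \notin J) -> forall a, L a -> S a].

Lemma exists_minimal_over_radical S : over_radical S ->
  (exists2 a, S a & a \notin J) ->
  exists L, minimal_over_radical L /\ forall a, L a -> S a.
Proof.
move: S; apply: radical_artinian_ind => S Sr IH Sn.
have [minS|] := pselect (forall S', over_radical S' -> (forall a, S' a -> S a) ->
        (exists2 a, S' a & a \notin J) -> forall a, S a -> S' a).
  by exists S.
rewrite -existsNE => -[S' /not_implyP[S'r /not_implyP[S'S /not_implyP[S'n nSS']]]].
have [L [Lm LS']] := IH S' S'r S'S nSS' S'n.
by exists L; split=> // a /LS' /S'S.
Qed.

(** [L] does not annihilate some graded simple module, hence maps onto it by
    evaluation at a homogeneous vector [v]; the kernel is the radical by
    minimality, and an element of [L] that fixes [v] is idempotent modulo it. *)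
Lemma minimal_over_radical_idempotent L : minimal_over_radical L ->
  exists l, [/\ L l, gr 0 l, l * l - l \in J & l \notin J].
Proof.
move=> [[hL LJ] [a La aJ] Lmin].
have [V [grV [Vs [v av]]]] : exists (V : lmodType A) (grV : pieces V),
    graded_simple gr grV /\ exists v : V, a *: v <> 0.
  apply: contrapT => noV; case/negP: aJ; apply/asboolP => V grV Vs v.
  by apply: contrapT => nz; apply: noV; exists V, grV; split => //; exists v.
have [V_gr _ Vsimple] := Vs; have [[_ _ span _] Vmul] := V_gr.
have {v av} [e [v [ve av]]] : exists e (v : V), grV e v /\ a *: v <> 0.
  have [s [f [fP vE]]] := span v; apply: contrapT => nov; apply: av.
  rewrite vE scaler_sumr big1 // => d _; apply: contrapT => nz; apply: nov.
  by exists d, (f d).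
pose N (w : V) := exists2 l, L l & w = l *: v.
have Nall w : N w.
  have [||N0|//] := Vsimple N.
  - split; first by exists 0; [apply: (hlideal0 hL)|rewrite scale0r].
    move=> b _ _ [l1 L1 ->] [l2 L2 ->]; exists (b * l1 + l2).
      by apply: (hlidealD hL) => //; apply: (hlidealMl _ hL).
    by rewrite scalerDl scalerA.
  - move=> _ [l Ll ->]; exists [seq d + e | d <- D], (fun d => c (d - e) l *: v).
    split=> [d|].
      split; last by exists (c (d - e) l) => //; case: hL => _; apply.
      by rewrite -[X in grV X](subrK e); apply: Vmul => //; apply: (comp_in cP).
    rewrite big_map [in LHS](comp_sum cP l) scaler_suml.
    by apply: eq_bigr => d _; rewrite addrK.
  by case: av; apply: N0; exists a.
have [l Ll /esym lv] := Nall v.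
have l0v : c 0 l *: v = v.
  by apply: (graded_action_comp V_gr ve) => //; rewrite add0r.
have vn : v <> 0 by move=> v0; apply: av; rewrite v0 scaler0.
exists (c 0 l); split; [by case: hL => _; apply|exact: (comp_in cP)| |].
  pose L' b := L b /\ b *: v = 0.
  have L'r : over_radical L'.
    split; first split; first split.
    - by split; [apply: (hlideal0 hL)|rewrite scale0r].
    - move=> b u w [Lu uv] [Lw wv]; split.
        by apply: (hlidealD hL) => //; apply: (hlidealMl _ hL).
      by rewrite scalerDl -scalerA uv wv scaler0 addr0.
    - move=> d b [Lb bv]; split; first by case: hL => _; apply.
      by apply: (graded_action_comp V_gr ve) => //; apply: (gr0 V_gr.1).
    - by move=> b bJ; split; [apply: LJ|apply: jacobson_kills bJ Vs].
  apply: contrapT => /negP nJ.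
  have [] := Lmin L' L'r (fun b h => h.1) _ a La; last by move=> _ /av.
  exists (c 0 l * c 0 l - c 0 l) => //; split.
    apply: (hlidealB hL); last by case: hL => _; apply.
    by apply: (hlidealMl _ hL); case: hL => _; apply.
  by rewrite scalerBl -scalerA !l0v subrr.
by apply/negP => lJ; apply: vn; rewrite -l0v; apply: jacobson_kills lJ Vs.
Qed.

(** The last clause says that the corner of [f] in degree zero is a local ring:
    of two elements with sum [f], one is left invertible. *)
Definition local_idempotent (f : A) : Prop :=
  [/\ gr 0 f, f * f = f &
      forall x, gr 0 x -> f * x = x -> x * f = x ->
        (exists y, y * x = f) \/ (exists y, y * (f - x) = f)].

Definition lideal_over (e : A) (a : A) : Prop :=
  exists b j, j \in J /\ a = b * e + j.

Lemma lideal_over_radical e : gr 0 e -> over_radical (lideal_over e).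
Proof.
move=> e0; split; last by move=> a aJ; exists 0, a; rewrite mul0r add0r.
split; first split.
- by exists 0, 0; rewrite mul0r addr0 rpred0.
- move=> a _ _ [b [j [jJ ->]]] [b' [j' [jJ' ->]]].
  exists (a * b + b'), (a * j + j'); split.
    by apply: rpredD => //; apply: tsidealMl.
  transitivity (a * (b * e + j) + (b' * e + j')); first by [].
  by rewrite mulrDr !mulrA mulrDl addrACA.
move=> d _ [b [j [jJ ->]]]; exists (c d b), (c d j); split.
  exact: jacobson_comp.
by rewrite (compD cP) -(compMr A_gr cP e0) addr0.
Qed.

Lemma lideal_over_self e : lideal_over e e.
Proof. by exists 1, 0; rewrite rpred0 mul1r addr0. Qed.

Lemma gr0M a b : gr 0 a -> gr 0 b -> gr 0 (a * b).
Proof. by move=> a0 b0; rewrite -[X in gr X _]addr0; apply: (grM A_gr). Qed.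

Lemma homogeneous_idempotent_degree0 e : homogeneous gr e -> e * e = e -> gr 0 e.
Proof.
case=> d de ee; have [<-//|d0] := eqVneq d 0.
have := grM A_gr de de; rewrite ee => dde.
suff -> : e = 0 by apply: (gr0 A_gr.1).
rewrite -[LHS](comp_id cP dde); apply: (comp_ne cP de).
by apply: contraNneq d0 => dd; apply/eqP/(addrI d); rewrite addr0.
Qed.

(** Idempotents lift into the corner [e A e]: if [g] lifts an idempotent of the
    corner modulo the radical then [1 - (g - g e)] is a unit that conjugates [g]
    into [A e]. *)
Lemma lift_idempotent_corner e x : gr 0 e -> e * e = e ->
  gr 0 x -> x * x - x \in J -> e * x - x \in J -> x * e - x \in J ->
  exists f, [/\ gr 0 f, f * f = f, e * f = f, f * e = f & f - x \in J].
Proof.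
move=> e0 ee x0 xx ex xe.
have xxq : piJ x * piJ x = piJ x by rewrite -qproj_mul; apply/qprojP.
have exq : piJ e * piJ x = piJ x by rewrite -qproj_mul; apply/qprojP.
have xeq : piJ x * piJ e = piJ x by rewrite -qproj_mul; apply/qprojP.
have [||g [ghom gg gx]] := A_semiperfect.2 (piJ x) => //.
  by exists 0; exists x.
have g0 := homogeneous_idempotent_degree0 ghom gg.
pose j := g - g * e.
have jJ : j \in J by apply/qprojP; rewrite qproj_mul gx xeq.
have j0 : gr 0 j by apply: (grD A_gr.1) => //; apply: (grN A_gr.1); apply: gr0M.
have [y [y0 yu uy]] := jacobson_inverse j0 jJ.
have yq : piJ y = 1.
  have -> : 1 = piJ 1 by [].
  apply/qprojP; rewrite -[in X in _ - X]yu mulrBr mulr1 opprB addrC subrK.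
  exact: tsidealMl.
have gu : g * (1 - j) = g * e.
  by rewrite /j mulrBr mulr1 mulrBr mulrA gg opprB addrC subrK.
(* [g'] is the conjugate of [g] by the unit [1 - j]. *)
pose g' := y * (g * e).
have g'g' : g' * g' = g'.
  rewrite /g' -gu -!mulrA [X in y * (g * X)]mulrA uy mul1r.
  by rewrite [g * (g * _)]mulrA gg.
have g'e : g' * e = g' by rewrite /g' -!mulrA ee.
exists (e * g'); split.
- by do ! apply: gr0M.
- by rewrite -mulrA [g' * (e * g')]mulrA g'e g'g'.
- by rewrite mulrA ee.
- by rewrite -mulrA g'e.
apply/qprojP; rewrite /g' !qproj_mul yq gx mul1r xeq.
exact: exq.
Qed.

(** Below the left ideal of [e] choose a minimal one over the radical.  Its
    idempotent modulo the radical lifts to [f] in the corner of [e].  By minimality,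
    any element of the corner of [f] outside the radical generates [f] modulo the
    radical, and inverses lift. *)
Lemma exists_local_idempotent e : gr 0 e -> e * e = e -> e <> 0 ->
  exists f, [/\ local_idempotent f, f \notin J, e * f = f & f * e = f].
Proof.
move=> e0 ee en.
have [|L [Lmin LS]] := exists_minimal_over_radical (lideal_over_radical e0).
  exists e; first exact: lideal_over_self.
  by apply/negP => eJ; apply: en; apply: idempotent_jacobson.
have [l [Ll l0 ll lJ]] := minimal_over_radical_idempotent Lmin.
have [[hL LJ] _ Lm] := Lmin.
have le : l * e - l \in J.
  have [b [j [jJ lE]]] := LS _ Ll.
  rewrite lE mulrDl -mulrA ee opprD addrACA subrr add0r.
  by apply: rpredB => //; apply: tsidealMr.
have llq : piJ l * piJ l = piJ l by rewrite -qproj_mul; apply/qprojP.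
have leq : piJ l * piJ e = piJ l by rewrite -qproj_mul; apply/qprojP.
have eeq : piJ e * piJ e = piJ e by rewrite -qproj_mul ee.
have [|||f [f0 ff ef fe fx]] := lift_idempotent_corner e0 ee (gr0M e0 l0).
- apply/qprojP; rewrite !qproj_mul.
  by rewrite mulrA -[X in X * _]mulrA leq -mulrA llq.
- by rewrite mulrA ee subrr rpred0.
- by apply/qprojP; rewrite !qproj_mul -mulrA leq.
have fJ : f \notin J.
  apply: contraNN lJ => fJ; rewrite -[l]subr0; apply/qprojP.
  have := fx; rewrite -qprojP => /esym; rewrite (_ : piJ f = piJ 0); last first.
    by apply/qprojP; rewrite subr0.
  rewrite qproj_mul qproj0 => elq.
  by rewrite -llq -[X in X * _]leq -mulrA elq mulr0.
have Lf : L f.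
  rewrite -(subrK (e * l) f); apply: (hlidealD hL); first exact: LJ.
  exact: hlidealMl.
exists f; split=> //; split=> // x x0 fx' xf.
have inv j : gr 0 j -> j \in J -> j * f = j -> exists y, y * (f - j) = f.
  move=> j0 jJ jf; have [y [_ yE]] := jacobson_left_inverse j0 jJ.
  exists y; rewrite -{2}[f]mul1r -yE -mulrA; congr (y * _).
  by rewrite mulrBl mul1r jf.
have [xJ|xJ] := boolP (x \in J); first by right; apply: inv.
left; have Lx a : lideal_over x a -> L a.
  move=> [b [j [jJ ->]]]; apply: (hlidealD hL); last exact: LJ.
  by rewrite -xf mulrA; apply: hlidealMl.
have [|a [j [jJ fE]]] := Lm _ (lideal_over_radical x0) Lx _ f Lf.
  by exists x => //; apply: lideal_over_self.
(* Only the component of degree zero of the cofactor matters. *)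
pose a0 := c 0 a.
have [|||y yE] := inv (f - f * a0 * x); rewrite ?subKr.
- apply: (grD A_gr.1) => //; apply: (grN A_gr.1); do ! apply: gr0M => //.
  exact: (comp_in cP).
- have -> : f - f * a0 * x = c 0 (f * j).
    have -> : f * j = f - f * (a * x).
      by rewrite -[X in X - _]ff {3}fE mulrDr addrAC subrr add0r.
    have cB u v : c 0 (u - v) = c 0 u - c 0 v.
      by apply/eqP; rewrite eq_sym subr_eq -(compD cP) subrK.
    rewrite cB (comp_id cP f0) -(addr0 0) -mulrA.
    rewrite -[X in f - X](_ : c (0 + 0) (f * (a * x)) = _) //.
    by rewrite addr0 -[X in c X _](addr0 0) (compMl A_gr cP f0)
       -[X in c X (a * x)](addr0 0) (compMr A_gr cP x0).
  by apply: jacobson_comp; apply: tsidealMl.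
- by rewrite mulrBl ff -[X in _ - X]mulrA xf.
by exists (y * (f * a0)); rewrite -[RHS]yE subKr -!mulrA.
Qed.

(** Splitting a local idempotent [f] off [e] replaces the left ideal of [e] over the
    radical by a strictly smaller one, that of [e - f]; so the process stops. *)
Lemma local_idempotent_decomposition :
  exists n (f : 'I_n -> A),
    [/\ forall t, local_idempotent (f t),
        forall t t', t != t' -> f t * f t' = 0 & \sum_t f t = 1].
Proof.
suff /(_ _ (lideal_over_radical (gr_one A_gr cP)) 1) [] : forall S, over_radical S ->
    forall e, gr 0 e -> e * e = e -> (forall a, S a -> lideal_over e a) ->
    (forall a, lideal_over e a -> S a) ->
  exists s : seq A,
    [/\ forall x, x \in s -> [/\ local_idempotent x, e * x = x & x * e = x],
        forall i j, (i < size s)%N -> (j < size s)%N -> i <> j -> s`_i * s`_j = 0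
        & \sum_(x <- s) x = e].
- exact: (gr_one A_gr cP).
- by rewrite mulr1.
- by [].
- by [].
- move=> s [sl so s1]; exists (size s), (fun t => s`_t); split.
  + by move=> t; have [|] := sl s`_t; rewrite ?mem_nth.
  + by move=> t t' tt'; apply: so => // E; case/eqP: tt'; apply: val_inj.
  + by rewrite -[RHS]s1 [RHS](big_nth 0) big_mkord.
apply: radical_artinian_ind => S Sr IH e e0 ee Se eS.
have [->|/eqP en] := eqVneq e 0.
  by exists [::]; split=> //; rewrite big_nil.
have [f [fl fJ ef fe]] := exists_local_idempotent e0 ee en.
have [f0 ff _] := fl.
pose e' := e - f.
have e'0 : gr 0 e' by apply: (grD A_gr.1) => //; apply: (grN A_gr.1).
have e'e' : e' * e' = e'.
  by rewrite /e' mulrBl !mulrBr ee ef fe ff subrr subr0.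
have ee' : e * e' = e' by rewrite mulrBr ee ef.
have e'e : e' * e = e' by rewrite mulrBl ee fe.
have e'f : e' * f = 0 by rewrite mulrBl ef ff subrr.
have fe' : f * e' = 0 by rewrite mulrBr fe ff subrr.
have S'S a : lideal_over e' a -> S a.
  move=> [b [j [jJ ->]]]; apply: eS; exists (b * e'), j; split=> //.
  by rewrite -mulrA e'e.
have nSS' : ~ (forall a, S a -> lideal_over e' a).
  move=> SS'; have [|b [j [jJ fE]]] := SS' f.
    by apply: eS; exists f, 0; rewrite rpred0 fe addr0.
  case/negP: fJ; rewrite -ff {1}fE mulrDl -mulrA e'f mulr0 add0r.
  exact: tsidealMr.
have [s [sl so se]] := IH _ (lideal_over_radical e'0) S'S nSS' e' e'0 e'e'
  (fun a h => h) (fun a h => h).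
exists (f :: s); split; last by rewrite big_cons se addrC subrK.
  move=> x; rewrite inE => /predU1P[->//|xs].
  have [xl e'x xe'] := sl x xs; split=> //.
    by rewrite -e'x mulrA ee'.
  by rewrite -xe' -mulrA e'e.
move=> [|i] [|j] //=; rewrite !ltnS => ilt jlt ij.
- have [_ e'x _] := sl _ (mem_nth 0 jlt).
  by rewrite -e'x mulrA fe' mul0r.
- have [_ _ xe'] := sl _ (mem_nth 0 ilt).
  by rewrite -xe' -mulrA e'f mulr0.
- by apply: so => // E; apply: ij; rewrite E.
Qed.

End Radical.

(** * Algebras that are Morita equivalent to a local ring *)

Section MakeHom.
Variables (k : comNzRingType) (A : pzAlgType k) (gr : pieces A) (M N : gsmod gr).
Variables (f : M -> N) (fl : linear f).
Hypothesis fP : forall d v, gs_pieces d v -> gs_pieces d (f v).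

Definition make_hom : gshom M N := @GsHom _ _ _ M N (linear_fun fl) fP.
End MakeHom.

Section HomOps.
Variables (k : comNzRingType) (A : pzAlgType k) (gr : pieces A).

Lemma zero_hom_linear (M N : gsmod gr) : linear (fun _ : M => 0 : N).
Proof. by move=> a u v; rewrite scaler0 addr0. Qed.

Lemma zero_homP (M N : gsmod gr) (d : deg) (v : M) :
  gs_pieces d v -> gs_pieces d (0 : N).
Proof. by move=> _; apply: (gr0 (gs_axiom N).1). Qed.

Definition zero_hom (M N : gsmod gr) : gshom M N :=
  make_hom (@zero_hom_linear M N) (@zero_homP M N).

Lemma scalar_hom_linear x (M : gsmod gr) :
  linear (fun v : M => (alg_map x : A) *: v).
Proof. by move=> a u v; rewrite scalerDr !scalerA alg_mapC. Qed.

Lemma scalar_homP x (M : gsmod gr) (d : deg) (v : M) :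
  gs_pieces d v -> gs_pieces d ((alg_map x : A) *: v).
Proof. by move=> dv; apply: (grZ (gs_axiom M).1). Qed.

Definition scalar_hom x (M : gsmod gr) : gshom M M :=
  make_hom (@scalar_hom_linear x M) (@scalar_homP x M).
End HomOps.

Section Equivalence.
Variables (k : comNzRingType) (A B : pzAlgType k).
Variables (grA : pieces A) (grB : pieces B).
Variables (F : functor grA grB) (G : functor grB grA).
Hypothesis GF : natural_iso (functor_comp G F) (functor_id grA).

Lemma equivalence_faithful (M N : gsmod grA) (f g : gshom M N) :
  fmap F f =1 fmap F g -> f =1 g.
Proof.
case: GF => eta [theta [te et nat]] Ffg v.
have := nat _ _ f (theta M v); have := nat _ _ g (theta M v).
rewrite /= et => <- <-; by rewrite (fmap_ext (F := G) Ffg).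
Qed.

Lemma fmap_zero (M N : gsmod grA) v : fmap F (zero_hom M N) v = 0.
Proof.
have := @fmap_linear _ _ _ _ _ F M N (-1) (zero_hom M N) (zero_hom M N)
  (zero_hom M N).
rewrite !rmorphN1 => -> => [|u]; first by rewrite scaleN1r addNr.
by rewrite /= addr0 scaler0.
Qed.

Lemma fmap_scalar x (M : gsmod grA) v :
  fmap F (scalar_hom x M) v = (alg_map x : B) *: v.
Proof.
rewrite (@fmap_linear _ _ _ _ _ F M M x (gsid M) (zero_hom M M)).
  by rewrite fmap_id fmap_zero addr0.
by move=> u /=; rewrite addr0.
Qed.
End Equivalence.

(** The preimage is the image of [h] under the quasi-inverse, transported along the
    natural isomorphism. *)
Lemma equivalence_full (k : comNzRingType) (A B : pzAlgType k)
    (grA : pieces A) (grB : pieces B)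
    (F : functor grA grB) (G : functor grB grA) :
  natural_iso (functor_comp G F) (functor_id grA) ->
  natural_iso (functor_comp F G) (functor_id grB) ->
  forall (M N : gsmod grA) (h : gshom (F M) (F N)),
    exists f : gshom M N, fmap F f =1 h.
Proof.
move=> [eta [theta [te et nat]]] FG M N h.
exists (gscomp (eta N) (gscomp (fmap G h) (theta M))).
apply: (equivalence_faithful FG) => v.
have := nat _ _ (gscomp (eta N) (gscomp (fmap G h) (theta M))) v.
by move=> /(congr1 (theta N)); rewrite /= !te.
Qed.

Section TrivialAlgebra.
Variable k : comNzRingType.
Local Notation grk := (@trivial_pieces k^o : pieces k^o).

Lemma trivial_graded :
  @graded_Asupermodule k k^o grk ((k^o)^o) (@trivial_pieces k^o).
Proof.
split; last first.
  move=> d d' a v [->|->] [->|->]; rewrite ?scaler0 ?scale0r /trivial_pieces;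
    by [left; rewrite addr0|right].
split.
- by move=> d; right.
- move=> d x u v [->|->]; first by left.
  by move=> [->|->]; [left|right; rewrite scaler0 addr0].
- move=> v; exists [:: 0], (fun d => if d == 0 then v else 0).
  rewrite big_seq1 eqxx; split=> // d.
  by rewrite /trivial_pieces; case: eqP; [left|right].
- move=> s f us fP f0 d ds; case: (fP d) => [d0|//]; rewrite -[RHS]f0.
  rewrite (sum_only (i := d)) ?ds // => d' dd'.
  by case: (fP d') => // d'0; rewrite d0 d'0 eqxx in dd'.
Qed.

Definition triv_gsmod : gsmod grk := @GsMod k k^o grk ((k^o)^o) _ trivial_graded.

(** A homogeneous element of degree [d] is the same as a map from [k] to the shift
    by [d]. *)
Section Element.
Variables (M : gsmod grk) (d : deg) (m : M) (dm : gs_pieces d m).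

Definition element_fun (x : triv_gsmod) : gsshift d M := (x : k^o) *: m.
Lemma element_fun_linear : linear element_fun.
Proof. by move=> a u v; rewrite /element_fun scalerDl scalerA. Qed.
Lemma element_funP d' v : gs_pieces d' v -> gs_pieces d' (element_fun v).
Proof.
move=> dv; rewrite /= /element_fun; apply: (gs_axiom M).2 => //.
Qed.
Definition element_hom : gshom triv_gsmod (gsshift d M) :=
  make_hom element_fun_linear element_funP.
End Element.
End TrivialAlgebra.

Section MoritaLocal.
Variables (k : comNzRingType) (E : pzAlgType k) (gr : pieces E).
Hypothesis E_gr : graded_superalgebra gr.
Variables (D : seq deg) (c : deg -> E -> E).
Hypothesis cP : components gr D c.
Local Notation grk := (@trivial_pieces k^o : pieces k^o).

Definition regular_gsmod : gsmod gr := @GsMod k E gr E^o gr (regular_graded E_gr).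

(** The terms whose sums form the trace ideal of [Q]; asking for homogeneous [phi]
    and [q] makes each of them homogeneous. *)
Definition trace_term (Q : gsmod gr) (y : E) : Prop :=
  exists (e : deg) (phi : gshom Q (gsshift e regular_gsmod)) (d : deg) (q : Q),
    gs_pieces d q /\ y = phi q.

Definition in_trace (Q : gsmod gr) (x : E) : Prop :=
  exists s : seq E, (forall y, y \in s -> trace_term Q y) /\ x = \sum_(y <- s) y.

Lemma in_trace0 Q : in_trace Q 0.
Proof. by exists [::]; split=> //; rewrite big_nil. Qed.

Lemma in_traceD Q x y : in_trace Q x -> in_trace Q y -> in_trace Q (x + y).
Proof.
move=> [s [sP ->]] [t [tP ->]]; exists (s ++ t); rewrite big_cat; split=> // z.
by rewrite mem_cat => /orP[/sP|/tP].
Qed.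

Lemma in_trace_sum Q (J : Type) (s : seq J) (P : pred J) (f : J -> E) :
  (forall j, P j -> in_trace Q (f j)) -> in_trace Q (\sum_(j <- s | P j) f j).
Proof. by move=> h; apply: big_ind => //; [apply: in_trace0|apply: in_traceD]. Qed.

Lemma trace_term_in Q y : trace_term Q y -> in_trace Q y.
Proof.
by move=> ty; exists [:: y]; rewrite big_seq1; split=> // z; rewrite inE => /eqP ->.
Qed.

Lemma in_traceMl Q a x : in_trace Q x -> in_trace Q (a * x).
Proof.
move=> [s [sP ->]]; rewrite mulr_sumr big_seq; apply: in_trace_sum => y ys.
have [e [phi [d [q [dq ->]]]]] := sP y ys.
rewrite [a](comp_sum cP) mulr_suml; apply: in_trace_sum => d' _.
apply: trace_term_in; exists e, phi, (d' + d), (c d' a *: q); split.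
  by apply: (gs_axiom Q).2 => //; apply: (comp_in cP).
by rewrite linearZ.
Qed.

Lemma in_trace_comp Q d x : in_trace Q x -> in_trace Q (c d x).
Proof.
move=> [s [sP ->]]; rewrite (comp_big cP) big_seq; apply: in_trace_sum => y ys.
have ty := sP y ys; have [e [phi [d' [q [dq yE]]]]] := ty.
have dy : gr (d' + e) y by rewrite yE; exact: (gs_funP phi dq).
rewrite (comp_homogeneous cP _ dy).
by case: eqP => _; [apply: trace_term_in|apply: in_trace0].
Qed.

Lemma in_trace_submodule Q : submodule (V := E^o) (in_trace Q).
Proof.
split; first exact: in_trace0.
by move=> a u v tu tv; apply: in_traceD => //; apply: in_traceMl.
Qed.

Lemma in_trace_hom Q e (phi : gshom Q (gsshift e regular_gsmod)) q :
  in_trace Q (phi q).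
Proof.
have [[_ _ span _] _] := gs_axiom Q; have [s [f [fP ->]]] := span q.
have -> : phi (\sum_(d <- s) f d) = \sum_(d <- s) (phi (f d) : E).
  exact: (morph_sum (linear0 phi) (linearD phi)).
apply: in_trace_sum => d _; apply: trace_term_in.
by exists e, phi, d, (f d).
Qed.

(** The module [Q] corresponding to [k] has the homomorphisms of [k] into its
    shifts, and its trace is the whole algebra since [k] generates. *)
Lemma morita_progenerator : morita_equivalent gr grk ->
  exists Q : gsmod gr,
    [/\ forall d (f : gshom Q (gsshift d Q)), d != 0 -> forall q, f q = 0,
        forall f : gshom Q Q, exists x, forall q, f q = (alg_map x : E) *: q,
        forall x, (forall q : Q, (alg_map x : E) *: q = 0) -> x = 0 &
        in_trace Q 1].
Proof.
move=> [F [G [GF FG shift]]].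
have Ffull := equivalence_full GF FG.
have Ffaith := equivalence_faithful GF.
have [eta [theta [te et nat]]] := FG.
set T := triv_gsmod k; pose Q := G T.
pose t1 : F Q := theta T (1 : k).
have etaT (w : F Q) : w = (eta T w : k^o) *: t1.
  by rewrite /t1 -linearZ /GRing.scale /= mulr1 te.
have dt1 : gs_pieces 0 t1 by apply: (gs_funP (theta T)); left.
exists Q; split.
- move=> d f d0.
  have [sh [hs [hsh shh shnat]]] := shift d.
  apply: (Ffaith _ _ f (zero_hom Q (gsshift d Q))) => w.
  rewrite fmap_zero [w]etaT linearZ.
  suff -> : fmap F f t1 = 0 by exact: scaler0.
  have ds := gs_funP (sh Q) (gs_funP (fmap F f) dt1).
  have [d00|z] := gs_funP (eta T) (ds : gs_pieces (0 + d) (_ : F Q)).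
    by case/eqP: d0; rewrite -d00 add0r.
  rewrite -[LHS]hsh.
  suff -> : sh Q (fmap F f t1) = 0 by rewrite linear0.
  by rewrite [LHS]etaT; rewrite z scale0r.
- move=> f; exists (eta T (fmap F f t1)).
  apply: (Ffaith _ _ f (scalar_hom _ Q)) => w.
  rewrite fmap_scalar [w]etaT linearZ [fmap F f t1 in LHS]etaT !scalerA.
  by rewrite [LHS]scalerA; congr (_ *: _); exact: (@mulrC k).
- move=> x x0.
  have E0 : fmap F (scalar_hom x Q) t1 = 0.
    rewrite -(@fmap_zero _ _ _ _ _ F Q Q t1); apply: fmap_ext => q /=; exact: x0.
  rewrite fmap_scalar in E0.
  have x1 : x * 1 = 0 :> k.
    by have := congr1 (eta T) E0; rewrite linearZ linear0 et.
  by rewrite mulr1 in x1.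
have Nsub := in_trace_submodule Q.
(* The projection of the algebra modulo the trace vanishes: the functor sees it
   through maps out of [k], and those come from maps out of [Q]. *)
pose W : gsmod gr := @GsMod k E gr _ _
  (quotmod_graded Nsub (regular_graded E_gr) cP (@in_trace_comp Q)).
pose R := regular_gsmod.
have pP d (v : R) : gs_pieces d v -> @gs_pieces _ _ _ W d (mproj Nsub v).
  by move=> dv; exists v.
pose p : gshom R W := @make_hom _ _ _ R W (mproj Nsub) (mproj_linear Nsub) pP.
suff /(_ (1 : E)) /(mproj_eq0 Nsub) : p =1 zero_hom R W by [].
apply: Ffaith => w; rewrite fmap_zero.
have [[_ _ span _] _] := gs_axiom (F R); have [s [f [fP ->]]] := span w.
have -> : fmap F p (\sum_(d <- s) f d) = \sum_(d <- s) (fmap F p (f d)).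
  exact: (morph_sum (linear0 _) (linearD _)).
apply: big1 => d _; have dm := fP d; move: (f d) dm => m dm.
have [sh [hs [hsh shh shnat]]] := shift d.
pose mu := element_hom dm.
pose h : gshom (F Q) (F (gsshift d R)) := gscomp (hs R) (gscomp mu (eta T)).
have [phi phiE] := Ffull _ _ h.
have p0 : gscomp (gsshift_hom d p) phi =1 zero_hom Q (gsshift d W).
  by move=> q /=; apply/(mproj_eq0 Nsub); apply: in_trace_hom.
have := shnat _ _ p (fmap F phi t1); rewrite /= -fmap_comp.
rewrite (fmap_ext p0) fmap_zero linear0 phiE /= shh /t1 et.
by rewrite /linear_fun /element_fun scale1r => <-.
Qed.

Hypothesis loc : nonunits_additive k.

(** Write [1 = sum_i phi_i q_i] in the trace of [Q].  The endomorphisms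
    [q |-> phi_i q *: q_j] are scalars [C i j] with [q_j = sum_i C i j *: q_i], so
    one of them is a unit by Nakayama's lemma; after rescaling,
    [phi q' *: q = q'] for all [q'], and [phi q] is the idempotent. *)
Lemma morita_idempotent : morita_equivalent gr grk ->
  exists eps : E,
    [/\ gr 0 eps, eps * eps = eps,
        forall x, exists y, eps * x * eps = alg_map y * eps,
        forall y, alg_map y * eps = 0 -> y = 0 &
        exists n (a b : 'I_n -> E), 1 = \sum_i a i * eps * b i].
Proof.
move=> /morita_progenerator[Q [Q1 Q2 Q3 [s [sP s1]]]].
pose n := size s.
have tP (i : 'I_n) : trace_term Q s`_i by apply/sP/mem_nth.
pose e i := sval (cid (tP i)).
pose phi i : gshom Q (gsshift (e i) regular_gsmod) := sval (cid (svalP (cid (tP i)))).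
pose d i := sval (cid (svalP (cid (svalP (cid (tP i)))))).
pose q i : Q := sval (cid (svalP (cid (svalP (cid (svalP (cid (tP i)))))))).
have [dq sE] : (forall i, gs_pieces (d i) (q i)) /\ (forall i : 'I_n, s`_i = phi i (q i)).
  by split=> i; have [] := svalP (cid (svalP (cid (svalP (cid (svalP (cid (tP i)))))))).
have {}s1 : 1 = \sum_i (phi i (q i) : E).
  rewrite {1}s1 (big_nth 0) big_mkord; apply: eq_bigr => i _; exact: sE.
have CP i j : exists x, (x != 0 -> e i + d j = 0) /\
    forall q', (phi i q' : E) *: q j = (alg_map x : E) *: q'.
  pose f (q' : Q) : Q := (phi i q' : E) *: q j.
  have fl : linear f.
    by move=> a u v; rewrite /f linearD linearZ scalerDl scalerA.
  have fP d' v : gs_pieces d' v -> @gs_pieces _ _ _ Q (d' + (e i + d j)) (f v).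
    move=> dv; rewrite addrA; apply: (gs_axiom Q).2 => //.
    exact: (gs_funP (phi i) dv).
  have [ed|ed] := eqVneq (e i + d j) 0.
    have fP0 d' v : gs_pieces d' v -> gs_pieces d' (f v).
      by move=> /fP; rewrite ed addr0.
    by have [x xE] := Q2 (make_hom fl fP0); exists x.
  exists 0; rewrite eqxx; split=> // q'; rewrite rmorph0 scale0r.
  exact: (Q1 _ (@make_hom _ _ _ Q (gsshift (e i + d j) Q) f fl fP) ed).
pose C i j := sval (cid (CP i j)).
have C0 i j : C i j != 0 -> e i + d j = 0 by have [] := svalP (cid (CP i j)).
have CE i j q' : (phi i q' : E) *: q j = (alg_map (C i j) : E) *: q'.
  by have [_ ] := svalP (cid (CP i j)); apply.
(* Otherwise all [q j] vanish by Nakayama's lemma, hence so does 1. *)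
have [i [j [u uE]]] : exists i j, isunit (C i j).
  apply: contrapT => nC.
  have q0 : forall j, q j = 0.
    apply: (@nakayama k loc (restr Q) n q (fun j i => C i j)).
      by move=> j i uC; apply: nC; exists i, j.
    move=> j; rewrite -[LHS](scale1r (q j : Q)) s1 scaler_suml.
    by apply: eq_bigr => i _; rewrite CE.
  have E10 : (1 : E) = 0 by rewrite s1 big1 // => i _; rewrite q0 linear0.
  have /eqP : (1 : k) = 0 by apply: Q3 => q'; rewrite rmorph1 E10 scale0r.
  by rewrite oner_eq0.
have ed : e i + d j = 0.
  apply: C0; apply/eqP => Cij; move: uE; rewrite Cij mulr0 => /eqP.
  by rewrite eq_sym oner_eq0.
pose ph (q' : Q) : E := alg_map u * (phi i q' : E).
have phD : {morph ph : a b / a + b} by move=> a b; rewrite /ph linearD mulrDr.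
have phZ a q' : ph (a *: q') = a * ph q'.
  by rewrite /ph linearZ mulrA alg_mapC -mulrA.
have phq q' : ph q' *: q j = q'.
  by rewrite /ph -scalerA CE scalerA -rmorphM uE rmorph1 scale1r.
pose eps := ph (q j).
have phe q' : ph q' * eps = ph q' by rewrite -phZ phq.
exists eps; split.
- rewrite /eps /ph; apply: (grZ E_gr.1).
  by have := gs_funP (phi i) (dq j); rewrite /= addrC ed.
- exact: phe.
- move=> x.
  suff [y yE] : exists y, forall q', ph q' *: (x *: q j) = (alg_map y : E) *: q'.
    by exists y; rewrite -phZ -phZ -scalerA yE phZ.
  have hom_case d' : exists y, forall q', ph q' *: (c d' x *: q j)
      = (alg_map y : E) *: q'.
    pose g (q' : Q) : Q := ph q' *: (c d' x *: q j).
    have gl : linear g.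
      by move=> a v w; rewrite /g phD phZ scalerDl -scalerA.
    have gP d'' v : gs_pieces d'' v -> @gs_pieces _ _ _ Q (d'' + d') (g v).
      move=> dv; rewrite /g; have := gs_funP (phi i) dv => /= phv.
      have -> : d'' + d' = d'' + e i + (d' + d j).
        by rewrite addrACA ed addr0.
      apply: (gs_axiom Q).2; first exact: (grZ E_gr.1).
      by apply: (gs_axiom Q).2 => //; apply: (comp_in cP).
    have [d'0|d'0] := eqVneq d' 0.
      have gP0 d'' v : gs_pieces d'' v -> gs_pieces d'' (g v).
        by move=> /gP; rewrite d'0 addr0.
      by have [y yE] := Q2 (make_hom gl gP0); exists y.
    exists 0 => q'; rewrite rmorph0 scale0r.
    exact: (Q1 _ (@make_hom _ _ _ Q (gsshift d' Q) g gl gP) d'0).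
  pose y d' := sval (cid (hom_case d')).
  exists (\sum_(d' <- D) y d') => q'.
  rewrite [x in LHS](comp_sum cP) rmorph_sum !scaler_suml scaler_sumr.
  by apply: eq_bigr => d' _; rewrite (svalP (cid (hom_case d'))).
- move=> y ye; apply: Q3 => q'; rewrite -[q' in LHS]phq scalerA -phe.
  by rewrite mulrA alg_mapC -mulrA ye mulr0 scale0r.
exists n, (fun l => ph (q l)), (fun l => (phi l (q j) : E)).
rewrite s1; apply: eq_bigr => l _.
have lZ : phi l (ph (q l) *: q j) = ph (q l) *: phi l (q j) by rewrite linearZ.
by rewrite phq in lZ; rewrite phe; exact: lZ.
Qed.

End MoritaLocal.

(** * Graded endomorphism algebras *)

Section GradedMaps.
Variables (k : comNzRingType) (B : pzAlgType k) (gr : pieces B).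
Variables (D : seq deg) (c : deg -> B -> B).
Hypothesis cP : components gr D c.
Variables (V W : lmodType B) (grV : pieces V) (grW : pieces W).
Hypotheses (V_gr : graded_Asupermodule gr grV) (W_gr : graded_Asupermodule gr grW).
Variables (DV DW : seq deg) (cV : deg -> V -> V) (cW : deg -> W -> W).
Hypotheses (cVP : components grV DV cV) (cWP : components grW DW cW).

Lemma compZ b a : gr b a -> forall d v, cW (d + b) (a *: v) = a *: cW d v.
Proof.
move=> ba; apply: (comp_morph cWP cWP) => [u v|d v dv]; first exact: scalerDr.
by rewrite addrC; apply: W_gr.2.
Qed.

(** The component of degree [e] of [f], given by its values at homogeneous vectors. *)
Lemma linear_component (f : V -> W) e : linear f ->
  exists2 g : V -> W, linear g & forall d v, grV d v -> g v = cW (d + e) (f v).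
Proof.
move=> fl.
have fD : {morph f : u v / u + v} by move=> u v; rewrite -[u]scale1r fl !scale1r.
have f0 : f 0 = 0 by apply: (addrI (f 0)); rewrite -fD !addr0.
have fZ a v : f (a *: v) = a *: f v by rewrite -[a *: v]addr0 fl f0 addr0.
pose g v := \sum_(d <- DV) cW (d + e) (f (cV d v)).
have gD : {morph g : u v / u + v}.
  move=> u v; rewrite -big_split; apply: eq_bigr => d _.
  by rewrite /= (compD cVP) fD (compD cWP).
have gE d v : grV d v -> g v = cW (d + e) (f v).
  move=> dv; rewrite /g (sum_only (i := d)) ?(comp_uniq cVP) ?(comp_id cVP) //.
    by move=> d' d'd; rewrite (comp_ne cVP dv) // f0 (comp0 cWP).
  by move=> dD; rewrite -(comp_id cVP dv) (comp_out cVP) // f0 (comp0 cWP).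
exists g => // a u v; rewrite gD; congr (_ + _).
move: a; apply: (ext_homogeneous cP) => [a b|a b|b a ba] /=.
- by rewrite scalerDl gD.
- by rewrite scalerDl.
move: u; apply: (ext_homogeneous cVP) => [x y|x y|d x dx] /=.
- by rewrite scalerDr gD.
- by rewrite gD scalerDr.
rewrite (gE _ _ dx) (gE (b + d)); last exact: V_gr.2.
by rewrite fZ -(compZ ba) -addrA addrC.
Qed.
End GradedMaps.

Section GradedEndomorphisms.
Variables (k : comNzRingType) (B : pzAlgType k) (gr : pieces B).
Hypothesis B_gr : graded_superalgebra gr.
Variables (D : seq deg) (c : deg -> B -> B).
Hypothesis cP : components gr D c.
Variables (V : lmodType B) (grV : pieces V).
Hypothesis V_gr : graded_Asupermodule gr grV.
Variables (DV : seq deg) (cV : deg -> V -> V).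
Hypothesis cVP : components grV DV cV.
Local Notation E := (endo V).

Lemma endo_mulE (f g : E) v : (f * g) v = f (g v). Proof. by []. Qed.
Lemma endo_oneE v : (1 : E) v = v. Proof. by []. Qed.
Lemma endo_algE x (f : E) v : (alg_map x * f) v = (alg_map x : B) *: f v.
Proof. by []. Qed.
Lemma endo_sumE (J : Type) (s : seq J) (P : pred J) (F : J -> E) v :
  (\sum_(j <- s | P j) F j) v = \sum_(j <- s | P j) F j v.
Proof. exact: (morph_sum (f := fun f : E => f v)). Qed.

Definition endo_degrees : seq deg := undup [seq d - d' | d <- DV, d' <- DV].

Lemma endo_degreesP d d' : d \in DV -> d' \in DV -> d - d' \in endo_degrees.
Proof. by move=> dD dD'; rewrite mem_undup; apply: allpairs_f. Qed.

Lemma homogeneous_degree d v : grV d v -> d \notin DV -> v = 0.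
Proof. by move=> dv dD; rewrite -(comp_id cVP dv) (comp_out cVP). Qed.

Lemma endo_graded : graded_superalgebra (endo_pieces grV).
Proof.
split; last first.
  by move=> d d' f g df dg d'' v dv /=; rewrite -addrA; apply/df/dg.
split.
- by move=> d d' v _ /=; apply: (gr0 V_gr.1).
- move=> d x f g df dg d' v dv /=; apply: (grD V_gr.1); last exact: dg.
  by apply: (grZ V_gr.1); apply: df.
- move=> f.
  have comp e : exists g : E, forall d v, grV d v -> g v = cV (d + e) (f v).
    have [g gl gE] := linear_component cP V_gr V_gr cVP cVP e (endoP f).
    by exists (Endo gl).
  pose g e := sval (cid (comp e)).
  have gE e d v : grV d v -> g e v = cV (d + e) (f v).
    by rewrite /g; case: cid => h /= hE; apply: hE.
  exists endo_degrees, g; split.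
    by move=> e d v dv; rewrite (gE _ _ _ dv) addrC; apply: (comp_in cVP).
  apply: endo_ext => v; rewrite endo_sumE; move: v.
  apply: (ext_homogeneous cVP) => [u v|u v|d v dv] /=; first exact: endoD.
    by rewrite -big_split; apply: eq_bigr => e _; exact: endoD.
  have [dD|dD] := boolP (d \in DV); last first.
    by rewrite (homogeneous_degree dv dD) endo0 big1 // => e _; rewrite endo0.
  under eq_bigr => e _ do rewrite (gE _ _ _ dv).
  rewrite [LHS](comp_sum cVP).
  rewrite -(big_map (fun e => d + e) xpredT (fun e => cV e (f v))).
  apply: sum_support.
  + exact: (comp_uniq cVP).
  + by rewrite map_inj_uniq ?undup_uniq //; apply: addrI.
  + by move=> e; apply: (comp_out cVP).
  + move=> e eD; apply: (comp_out cVP); apply: contraNN eD => eD.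
    by apply/mapP; exists (e - d); [apply: endo_degreesP|rewrite addrC subrK].
- move=> s f us fP f0 e es; apply: endo_ext.
  apply: (ext_homogeneous cVP) => [u v|u v|d v dv] /=; first exact: endoD.
    by rewrite addr0.
  have [[_ _ _ free] _] := V_gr.
  have := free [seq e' + d | e' <- s] (fun e' => f (e' - d) v).
  move=> /(_ _ _ _ (e + d)); rewrite addrK; apply.
  + by rewrite map_inj_uniq //; apply: addIr.
  + by move=> e'; rewrite -[X in grV X](subrK d); apply: fP.
  + rewrite big_map; have := congr1 (fun h : E => h v) f0.
    rewrite [X in X = _ -> _]endo_sumE => h; rewrite -[RHS]h.
    by apply: eq_bigr => e' _; rewrite addrK.
  + exact: map_f.
Qed.

Lemma endo_supported : supported (endo_pieces grV) endo_degrees.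
Proof.
split=> [|e f fe eD]; first exact: undup_uniq.
apply: endo_ext; apply: (ext_homogeneous cVP) => [u v|u v|d v dv] /=.
- exact: endoD.
- by rewrite addr0.
have [dD|dD] := boolP (d \in DV); last first.
  by rewrite (homogeneous_degree dv dD) endo0.
apply: (homogeneous_degree (fe _ _ dv)); apply: contraNN eD => eD.
by rewrite -(addrK d e); apply: endo_degreesP.
Qed.
End GradedEndomorphisms.

(** * Heredity ideals are generated by a primitive idempotent *)

Section HeredityIdeal.
Variables (k : comNzRingType) (B : pzAlgType k) (gr : pieces B).
Hypothesis loc : nonunits_additive k.
Hypothesis B_gr : graded_superalgebra gr.
Variables (D : seq deg) (c : deg -> B -> B).
Hypothesis cP : components gr D c.
Variable J : tsideal B.
Local Notation V := (ideal_module J).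
Local Notation grV := (ideal_pieces gr J).
Hypothesis J_hered : indecomposable_split_heredity_ideal gr J.
Hypothesis J_fg : exists n (p : 'I_n -> V),
  (forall i, homogeneous grV (p i)) /\
  forall v, exists b : 'I_n -> B, v = \sum_i b i *: p i.
Variables (N : nat) (f : 'I_N -> B).
Hypothesis f0 : forall t, gr 0 (f t).
Hypothesis ff : forall t, f t * f t = f t.
Hypothesis f1 : \sum_t f t = 1.
Hypothesis f_prim : forall t u, gr 0 u -> u * u = u ->
  f t * u = u -> u * f t = u -> u = 0 \/ u = f t.

Lemma ideal_dual_basis : exists n (p : 'I_n -> V) (h : 'I_n -> V -> B),
  [/\ forall i, homogeneous grV (p i),
      forall i a u v, h i (a *: u + v) = a * h i u + h i v &
      forall v, v = \sum_i h i v *: p i].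
Proof.
have [n [p [p_hom gen]]] := J_fg; have [_ _ J_proj _ _] := J_hered.
by have [h [hl hE]] := projective_dual_basis J_proj gen; exists n, p, h.
Qed.

(** For the idempotent [eps] of [End J] given by the Morita equivalence, the
    decomposition of the identity of [J] through a dual basis and the [f t]
    contains a term that [eps] compresses to a unit multiple of itself.  Hence
    [eps] factors as [v |-> gamma v *: p'] through some [B f t], and [gamma p'] is
    a nonzero idempotent of the corner of [f t], that is [f t] itself. *)
Lemma heredity_idempotent : exists t : 'I_N,
  [/\ f t \in J,
      forall b, exists x, f t * b * f t = alg_map x * f t,
      forall x, alg_map x * f t = 0 -> x = 0 &
      exists n (g : 'I_n -> V -> B) (z : 'I_n -> B),
        [/\ forall l, z l \in J /\ f t * z l = z l,
            forall l v, g l v * f t = g l v,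
            forall l a u v, g l (a *: u + v) = a * g l u + g l v &
            forall v, (val v : B) = \sum_l g l v * z l]].
Proof.
have [J_hom _ _ J_sq J_morita] := J_hered.
have V_gr : graded_Asupermodule gr grV := ideal_graded B_gr cP J_hom.
have [cV cVP] := exists_components V_gr.1 (ideal_supported cP J).
have E_gr := endo_graded cP V_gr cVP.
have [cE cEP] := exists_components E_gr.1 (endo_supported cVP).
have [eps [eps0 epsM eps_corner eps_free [m [a [b ab1]]]]] :=
  morita_idempotent E_gr cEP loc J_morita.
have epsE v : eps (eps v) = eps v by rewrite -endo_mulE epsM.
have [n [p [h [p_hom hl hE]]]] := ideal_dual_basis.
have wP (it : 'I_n * 'I_N) (x : B) u v :
    (h it.1 (x *: u + v) * f it.2) *: p it.1
    = x *: ((h it.1 u * f it.2) *: p it.1) + (h it.1 v * f it.2) *: p it.1.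
  by rewrite hl mulrDl scalerDl scalerA mulrA.
pose w it : endo V := Endo (wP it).
(* The identity of [J] factors through the modules [B f t]. *)
have w1 : 1 = \sum_it w it.
  apply: endo_ext => v; rewrite endo_sumE [LHS]hE.
  rewrite -(pair_bigA _ (fun i t => (h i v * f t) *: p i)) /=.
  by apply: eq_bigr => i _; rewrite -scaler_suml -mulr_sumr f1 mulr1.
pose C it := sval (cid (eps_corner (w it))).
have CE it : eps * w it * eps = alg_map (C it) * eps by rewrite /C; case: cid.
have C1 : \sum_it C it = 1.
  apply/eqP; rewrite -subr_eq0; apply/eqP/eps_free.
  rewrite rmorphB rmorph1 mulrBl mul1r rmorph_sum mulr_suml.
  rewrite -[X in _ - X](_ : eps * (\sum_it w it) * eps = _); last first.
    by rewrite -w1 mulr1.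
  rewrite mulr_sumr mulr_suml -sumrB; apply: big1 => it _.
  by rewrite CE subrr.
have [[i t] [u uE]] := unit_summand loc C1.
pose gam' (v : V) : B := alg_map u * (h i (eps v) * f t).
pose p' : V := f t *: eps (p i).
have gam'P v : gam' v *: p' = eps v.
  have : (eps * w (i, t) * eps) v = (alg_map (C (i, t)) * eps) v by rewrite CE.
  rewrite endo_algE !endo_mulE [w _ _]/= endoZ => Cv.
  rewrite /gam' /p' scalerA -!mulrA ff -scalerA Cv scalerA -rmorphM uE.
  by rewrite rmorph1 scale1r.
have gam'l : linear (gam' : V -> B^o).
  move=> x v v'; rewrite /gam' endoP hl mulrDl mulrDr -mulrA.
  by rewrite [alg_map u * (x * _)]mulrA alg_mapC -[x * _ * _]mulrA.
have [dp dp_p] := p_hom i.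
have dp_p' : grV dp p'.
  rewrite -[dp]add0r; apply: V_gr.2; first exact: f0.
  by rewrite -[dp]add0r; apply: eps0.
have eps_p' : eps p' = p' by rewrite /p' endoZ epsE.
have fp' : f t *: p' = p' by rewrite /p' scalerA ff.
clearbody p'.
(* [gam'] need not be homogeneous; its component of degree [- dp] does the same. *)
have [gam gaml gamE] := linear_component (W := B^o) cP V_gr (regular_graded B_gr)
  cVP cP (- dp) gam'l.
have gamD : {morph gam : v v' / v + v'}.
  by move=> v v'; rewrite -[v]scale1r gaml !scale1r.
have gam0 : gam 0 = 0 by apply: (addrI (gam 0)); rewrite -gamD !addr0.
have gamZ x v : gam (x *: v) = x * gam v.
  by rewrite -[x *: v]addr0 gaml gam0 addr0.
have gam_deg d v : grV d v -> gr (d - dp) (gam v).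
  by move=> dv; rewrite (gamE _ _ dv); apply: (comp_in cP).
have gamP v : gam v *: p' = eps v.
  move: v; apply: (ext_homogeneous cVP) => [v v'|v v'|d v dv] /=.
  - by rewrite gamD scalerDl.
  - exact: endoD.
  rewrite (gamE _ _ dv).
  apply: (graded_action_comp cP V_gr dp_p'); last exact: gam'P.
  by rewrite subrK -[d]add0r; apply: eps0.
have gamf v : gam v * f t = gam v.
  move: v; apply: (ext_homogeneous cVP) => [v v'|v v'|d v dv] //=.
    by rewrite gamD mulrDl.
  rewrite (gamE _ _ dv) -(compMr B_gr cP (f0 t)) addr0; congr (c _ _).
  by rewrite /gam' -!mulrA ff.
have gam_eps v : gam (eps v) = gam v.
  move: v; apply: (ext_homogeneous cVP) => [v v'|v v'|d v dv] //=.
    by rewrite endoD gamD.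
  have deps : grV d (eps v) by rewrite -[d]add0r; apply: eps0.
  by rewrite (gamE _ _ dv) (gamE _ _ deps) /gam' epsE.
(* [gam p'] is idempotent since [gam p' * gam p' = gam (eps p')]. *)
have gam_p' : gam p' = f t.
  have [||||gp0|//] := f_prim (t := t) (u := gam p').
  - by rewrite -(subrr dp); apply: gam_deg.
  - by rewrite -gamZ gamP gam_eps.
  - by rewrite -gamZ fp'.
  - exact: gamf.
  have p'0 : p' = 0 by rewrite -eps_p' -gamP gp0 scale0r.
  have /eps_free/eqP : alg_map 1 * eps = 0 :> endo V.
    apply: endo_ext => v; rewrite rmorph1 mul1r -gamP p'0.
    exact: scaler0.
  by rewrite oner_eq0.
exists t; split.
- have [_ /(_ (ideal_valP p'))[r [y [z [yzJ pE]]]]] := J_sq (val p').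
  pose z' l : V := ideal_elt (yzJ l).2.
  have p'E : p' = \sum_l y l *: z' l.
    apply: val_inj; rewrite ideal_val_sum [LHS]pE; apply: eq_bigr => l _.
    by rewrite ideal_valZ ideal_eltK.
  rewrite -gam_p' p'E (morph_sum gam0 gamD); apply: rpred_sum => l _.
  by rewrite gamZ; apply: tsidealMr; case: (yzJ l).
- move=> x.
  have WP (y : B) v v' : (gam (y *: v + v') * x) *: p'
      = y *: ((gam v * x) *: p') + (gam v' * x) *: p'.
    by rewrite gamD gamZ mulrDl scalerDl [X in _ = X + _]scalerA mulrA.
  have [y yE] := eps_corner (Endo WP); exists y.
  have : gam ((eps * Endo WP * eps) p') = gam ((alg_map y * eps) p') by rewrite yE.
  rewrite endo_algE !endo_mulE eps_p' [Endo _ _]/= gam_p' endoZ eps_p' !gamZ.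
  by rewrite gam_p'.
- move=> x xf; apply: eps_free; apply: endo_ext => v.
  rewrite endo_algE -gamP scalerA alg_mapC -scalerA -fp' [alg_map x *: _]scalerA xf.
  by rewrite scale0r scaler0.
exists m, (fun l v => gam (b l v)), (fun l => val (a l p')); split.
- move=> l; split; first exact: ideal_valP.
  by rewrite -ideal_valZ -endoZ fp'.
- by move=> l v; apply: gamf.
- by move=> l x v v'; rewrite endoP gaml.
move=> v; have := congr1 (fun g : endo V => g v) ab1.
rewrite endo_sumE endo_oneE => vE; rewrite [in LHS]vE ideal_val_sum.
apply: eq_bigr => l _.
by rewrite !endo_mulE -gamP endoZ ideal_valZ.
Qed.
End HeredityIdeal.

(** * Bases of graded summands over a local ring *)

Section BasisModulo.
Variables (k : comNzRingType) (W : lmodType k).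
Variable K : W -> Prop.
Hypothesis K0 : K 0.
Hypothesis Klin : forall c u v, K u -> K v -> K (c *: u + v).

Lemma modD u v : K u -> K v -> K (u + v).
Proof. by move=> Ku Kv; rewrite -[u]scale1r; apply: Klin. Qed.
Lemma modZ c u : K u -> K (c *: u).
Proof. by move=> Ku; rewrite -[_ *: _]addr0; apply: Klin. Qed.
Lemma mod_sum (J : Type) (s : seq J) (P : pred J) (F : J -> W) :
  (forall j, P j -> K (F j)) -> K (\sum_(j <- s | P j) F j).
Proof. by move=> h; apply: big_ind => //; apply: modD. Qed.

Definition in_span_mod (s : seq W) (v : W) : Prop :=
  exists c : W -> k, K (v - \sum_(x <- s) c x *: x).

Lemma in_span_mod0 s v : K v -> in_span_mod s v.
Proof.
by move=> Kv; exists (fun=> 0); rewrite big1 ?subr0 // => x _; rewrite scale0r.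
Qed.

Lemma in_span_modD s u v :
  in_span_mod s u -> in_span_mod s v -> in_span_mod s (u + v).
Proof.
move=> [c cE] [c' cE']; exists (fun x => c x + c' x).
under eq_bigr => x _ do rewrite scalerDl.
by rewrite big_split opprD addrACA; apply: modD.
Qed.

Lemma in_span_modZ s a v : in_span_mod s v -> in_span_mod s (a *: v).
Proof.
move=> [c cE]; exists (fun x => a * c x).
under eq_bigr => x _ do rewrite -scalerA.
by rewrite -scaler_sumr -scalerBr; apply: modZ.
Qed.

Lemma in_span_mod_sum s (J : Type) (r : seq J) (P : pred J) (F : J -> W) :
  (forall j, P j -> in_span_mod s (F j)) -> in_span_mod s (\sum_(j <- r | P j) F j).
Proof.
by move=> h; apply: big_ind => //; [apply: in_span_mod0|apply: in_span_modD].
Qed.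

Lemma sum_delta s x : uniq s -> x \in s ->
  \sum_(y <- s) (x == y)%:R *: y = x :> W.
Proof.
move=> us xs; rewrite (sum_only (i := x)) ?eqxx ?scale1r ?xs //.
by move=> y; rewrite eq_sym => /negPf ->; rewrite scale0r.
Qed.

Lemma in_span_mod_mem s x : uniq s -> x \in s -> in_span_mod s x.
Proof.
by move=> us xs; exists (fun y => (x == y)%:R); rewrite sum_delta ?subrr.
Qed.

Definition free_mod (s : seq W) : Prop :=
  forall c : W -> k, K (\sum_(x <- s) c x *: x) -> forall x, x \in s -> c x = 0.

Lemma free_mod_nz s x : uniq s -> free_mod s -> x \in s -> x != 0.
Proof.
move=> us fs xs; apply/eqP => x0.
have /fs/(_ x xs)/eqP : K (\sum_(y <- s) (x == y)%:R *: y).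
  by rewrite sum_delta // x0.
by rewrite eqxx oner_eq0.
Qed.

Hypothesis loc : nonunits_additive k.
Variables (n : nat) (a : 'I_n -> W) (al : 'I_n -> W -> k).
Hypothesis al_lin : forall i c u v, al i (c *: u + v) = c * al i u + al i v.
Hypothesis alE : forall v, v = \sum_i al i v *: a i.
Variable sigma : W -> W.
Hypothesis sigl : linear sigma.
Hypothesis sigK : forall v, K (sigma v - v).
Hypothesis sig0 : forall v, K v -> sigma v = 0.
Variable p : W -> W.
Hypothesis pl : linear p.
Hypothesis pp : forall v, p (p v) = p v.
Hypothesis pK : forall v, K v -> K (p v).
Variable S : W -> Prop.

Definition spans_mod (s : seq W) : Prop :=
  forall v, p v = v -> in_span_mod s v.

(** A generating list of minimal length: all coefficients of a relation are
    non-units.  Projectivity provides coordinate functions that vanish on [K], so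
    that the coefficients of a relation are killed by a matrix congruent to the
    identity modulo the maximal ideal. *)
Lemma exists_basis_mod :
  (exists s, [/\ uniq s, forall x, x \in s -> S x /\ p x = x & spans_mod s]) ->
  exists s, [/\ uniq s, forall x, x \in s -> S x /\ p x = x, spans_mod s &
    free_mod s].
Proof.
pose P m := `[< exists s, [/\ uniq s, forall x, x \in s -> S x /\ p x = x,
  spans_mod s & size s = m] >].
move=> [s0 [us0 Ss0 sps0]].
have exP : exists m, P m by exists (size s0); apply/asboolP; exists s0.
case: (ex_minnP exP) => m /asboolP[s [us Ss sps sz]] mmin.
exists s; split=> //.
(* A unit coefficient would allow the removal of [x0]. *)
have nonunit c x0 : K (\sum_(x <- s) c x *: x) -> x0 \in s -> ~ isunit (c x0).
  move=> Kc x0s [u uE].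
  have : P (size (rem x0 s)).
    apply/asboolP; exists (rem x0 s); split=> //; first exact: rem_uniq.
      by move=> x /mem_rem /Ss.
    move=> v /sps[d dE]; exists (fun x => d x - d x0 * u * c x).
    under eq_bigr => x _ do rewrite scalerBl -scalerA.
    rewrite sumrB -scaler_sumr.
    have E : \sum_(x <- rem x0 s) d x *: x - (d x0 * u) *: \sum_(x <- rem x0 s) c x *: x
        = \sum_(x <- s) d x *: x - (d x0 * u) *: \sum_(x <- s) c x *: x.
      rewrite [in RHS](perm_big _ (perm_to_rem x0s)) big_cons.
      rewrite [in RHS](perm_big _ (perm_to_rem x0s)) big_cons /=.
      rewrite scalerDr scalerA -mulrA uE mulr1 opprD addrACA subrr add0r.
      by [].
    by rewrite E opprB addrCA; apply: modD => //; apply: modZ.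
  move=> /mmin; rewrite -sz size_rem //; case: s x0s {us Ss sps sz Kc} => // y s _.
  by rewrite ltnn.
have p0 : p 0 = 0 by apply: (addrI (p 0)); rewrite -{1}[p 0]scale1r -pl scaler0 !addr0.
have pD : {morph p : u v / u + v} by move=> u v; rewrite -[u]scale1r pl !scale1r.
have pZ x v : p (x *: v) = x *: p v by rewrite -[_ *: v]addr0 pl p0 addr0.
have al0 i : al i 0 = 0.
  by apply: (addrI (al i 0)); rewrite -{1}[al i 0]mul1r -al_lin scaler0 !addr0.
have alD i : {morph al i : u v / u + v}.
  by move=> u v; rewrite -[u]scale1r al_lin mul1r scale1r.
have alZ i x v : al i (x *: v) = x * al i v.
  by rewrite -[x *: v]addr0 al_lin al0 addr0.
have sD : {morph sigma : u v / u + v}.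
  by move=> u v; rewrite -[u]scale1r sigl !scale1r.
have s00 : sigma 0 = 0 by exact: sig0.
have sZ x v : sigma (x *: v) = x *: sigma v by rewrite -[_ *: v]addr0 sigl s00 addr0.
pose tau v := p (sigma v).
have lamP l : exists d : W -> k, K (p (a l) - \sum_(x <- s) d x *: x).
  exact: sps.
pose lam l := sval (cid (lamP l)).
have lamE l : K (p (a l) - \sum_(x <- s) lam l x *: x).
  by rewrite /lam; case: cid.
pose M x y := \sum_l al l (tau x) * lam l y.
have ME x : x \in s -> K (x - \sum_(y <- s) M x y *: y).
  move=> xs; have px := (Ss x xs).2.
  have -> : x - \sum_(y <- s) M x y *: y = (p x - p (sigma x)) +
      \sum_l al l (tau x) *: (p (a l) - \sum_(y <- s) lam l y *: y).
    under [X in _ = _ + X]eq_bigr => l _ do rewrite scalerBr.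
    rewrite sumrB px -[p (sigma x)]pp {1}[p (sigma x)]alE.
    rewrite (morph_sum p0 pD).
    under [X in _ = _ - X + _]eq_bigr => l _ do rewrite pZ.
    rewrite addrA subrK; congr (_ - _).
    under [RHS]eq_bigr => l _ do rewrite scaler_sumr.
    rewrite exchange_big /=; apply: eq_bigr => y _.
    by rewrite /M scaler_suml; apply: eq_bigr => l _; rewrite scalerA.
  apply: modD; last by apply: mod_sum => l _; apply: modZ.
  have -> : p x - p (sigma x) = p (x - sigma x).
    by rewrite pD -scaleN1r -[in RHS]scaleN1r pZ.
  by apply: pK; rewrite -opprB -scaleN1r; apply: modZ.
pose N (i j : 'I_(size s)) := ((s`_j == s`_i)%:R - M s`_j s`_i : k).
have nN i j : ~ isunit (N i j).
  pose d y := ((s`_j == y)%:R - M s`_j y : k).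
  apply: (nonunit d); last exact: mem_nth.
  under eq_bigr => y _ do rewrite scalerBl.
  by rewrite sumrB sum_delta ?mem_nth //; apply: ME; rewrite mem_nth.
move=> c Kc.
have c0 : forall i : 'I_(size s), c s`_i = 0 :> k^o.
  apply: (nakayama loc nN) => i.
  have idx (V : nmodType) (F : W -> V) : \sum_(j < size s) F s`_j = \sum_(x <- s) F x.
    by rewrite [RHS](big_nth 0) big_mkord.
  rewrite (idx _ (fun x => ((x == s`_i)%:R - M x s`_i : k) *: (c x : k^o))).
  transitivity (\sum_(x <- s) ((x == s`_i)%:R * c x - M x s`_i * c x)); last first.
    by apply: eq_bigr => x _; rewrite -mulrBl.
  rewrite sumrB (sum_only (i := s`_i)) ?eqxx ?mul1r //; last 2 first.
  - by move=> x /negPf ->; rewrite mul0r.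
  - by rewrite mem_nth.
  suff -> : \sum_(x <- s) M x s`_i * c x = 0 by rewrite subr0.
  transitivity (\sum_l lam l s`_i * al l (tau (\sum_(x <- s) c x *: x))).
    rewrite /M; under eq_bigr => x _ do rewrite mulr_suml.
    rewrite exchange_big /=; apply: eq_bigr => l _.
    rewrite /tau (morph_sum s00 sD) (morph_sum p0 pD) (morph_sum (al0 l) (alD l)).
    rewrite mulr_sumr; apply: eq_bigr => x _.
    by rewrite sZ pZ alZ -mulrA [RHS]mulrA [RHS]mulrC.
  by rewrite big1 // => l _; rewrite /tau sig0 // p0 al0 mulr0.
move=> x xs; have ilt : (index x s < size s)%N by rewrite index_mem.
by have := c0 (Ordinal ilt); rewrite /= nth_index.
Qed.
End BasisModulo.

Section GradedBasis.
Variables (k : comNzRingType) (W : lmodType k).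
Variable K : W -> Prop.
Hypothesis K0 : K 0.
Hypothesis Klin : forall c u v, K u -> K v -> K (c *: u + v).
Hypothesis loc : nonunits_additive k.
Variables (n : nat) (a : 'I_n -> W) (al : 'I_n -> W -> k).
Hypothesis al_lin : forall i c u v, al i (c *: u + v) = c * al i u + al i v.
Hypothesis alE : forall v, v = \sum_i al i v *: a i.
Variable sigma : W -> W.
Hypothesis sigl : linear sigma.
Hypothesis sigK : forall v, K (sigma v - v).
Hypothesis sig0 : forall v, K v -> sigma v = 0.
Variables (T : finType) (p : T -> W -> W).
Hypothesis pl : forall i, linear (p i).
Hypothesis pp : forall i j v, p i (p j v) = if i == j then p i v else 0.
Hypothesis pK : forall i v, K v -> K (p i v).

(** The projections of a generating family of [W] form a generating list of
    vectors fixed by one of them, to which the preceding lemma applies. *)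
Lemma exists_graded_basis_mod :
  exists s, [/\ uniq s, forall x, x \in s -> exists i, p i x = x,
    forall v, \sum_i p i v = v -> in_span_mod K s v & free_mod K s].
Proof.
pose q v := \sum_i p i v.
have p0 i : p i 0 = 0.
  by apply: (addrI (p i 0)); rewrite -{1}[p i 0]scale1r -pl scaler0 !addr0.
have pD i : {morph p i : u v / u + v}.
  by move=> u v; rewrite -[u]scale1r pl !scale1r.
have pZ i x v : p i (x *: v) = x *: p i v by rewrite -[_ *: v]addr0 pl p0 addr0.
have qp i v : q (p i v) = p i v.
  rewrite /q (bigD1 i) //= pp eqxx big1 ?addr0 // => j ji.
  by rewrite pp (negPf ji).
have ql : linear q.
  move=> x u v; rewrite /q scaler_sumr -big_split.
  by apply: eq_bigr => i _; rewrite pl.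
have q0 : q 0 = 0 by rewrite /q big1.
have qD : {morph q : u v / u + v} by move=> u v; rewrite -[u]scale1r ql !scale1r.
have qq v : q (q v) = q v.
  by rewrite {2 3}/q (morph_sum q0 qD); apply: eq_bigr => i _; rewrite qp.
have qK v : K v -> K (q v).
  by move=> Kv; apply: (mod_sum K0 Klin) => i _; apply: pK.
have [|s [us sP sps fs]] :=
  exists_basis_mod K0 Klin loc al_lin alE sigl sigK sig0 ql qq qK
    (S := fun x => exists i, p i x = x).
  exists (undup [seq p il.1 (a il.2) | il : T * 'I_n]); split.
  - exact: undup_uniq.
  - move=> x; rewrite mem_undup => /mapP[[i l] _ ->] /=; split; last exact: qp.
    by exists i; rewrite pp eqxx.
  move=> v <-; apply: (in_span_mod_sum K0 Klin) => i _.
  rewrite [v]alE (morph_sum (p0 i) (pD i)).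
  apply: (in_span_mod_sum K0 Klin) => l _; rewrite pZ.
  apply: (in_span_modZ K0 Klin); apply: (in_span_mod_mem K0); first exact: undup_uniq.
  by rewrite mem_undup; apply/mapP; exists (i, l); rewrite ?mem_enum.
by exists s; split=> // x /sP[].
Qed.

(** Applying [pi] to a relation leaves only the term of [e]. *)
Lemma free_mod_cons (pi : W -> W) (e : W) (s : seq W) :
  linear pi -> (forall v, K v -> K (pi v)) -> pi e = e ->
  (forall x, x \in s -> pi x = 0) -> (forall x, K (x *: e) -> x = 0) ->
  free_mod K s -> e \notin s /\ free_mod K (e :: s).
Proof.
move=> pil piK pie pis fe fs.
have pi0 : pi 0 = 0.
  by apply: (addrI (pi 0)); rewrite -{1}[pi 0]scale1r -pil scaler0 !addr0.
have piD : {morph pi : u v / u + v}.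
  by move=> u v; rewrite -[u]scale1r pil !scale1r.
have piZ x v : pi (x *: v) = x *: pi v by rewrite -[_ *: v]addr0 pil pi0 addr0.
split.
  apply/negP => es; have /eqP : (1 : k) = 0.
    by apply: fe; rewrite scale1r -pie pis.
  by rewrite oner_eq0.
move=> c; rewrite big_cons => Kc.
have ce : c e = 0.
  apply: fe; have := piK _ Kc; rewrite piD piZ pie.
  rewrite (morph_sum pi0 piD) big1_seq ?addr0 // => x /= xs.
  by rewrite piZ pis // scaler0.
move=> x; rewrite inE => /predU1P[->//|xs]; apply: fs => //.
by rewrite ce scale0r add0r in Kc.
Qed.

Lemma in_span_mod_cons e s v :
  e \notin s -> in_span_mod K s v -> in_span_mod K (e :: s) v.
Proof.
move=> es [c Kc]; exists (fun x => if x == e then 0 else c x).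
rewrite big_cons eqxx scale0r add0r.
rewrite (eq_big_seq (fun x => c x *: x)) // => x xs.
by case: eqP es => // <-; rewrite xs.
Qed.
End GradedBasis.

(** * A layer of the heredity chain *)

(** The part of heredity data that lives in one layer [K / K'] of a heredity
    chain: [X] and [Y] lift bases of [A e] and [e A] modulo [K'], and their products
    lift a basis of the layer. *)
Record layer_basis (k : comNzRingType) (A : pzAlgType k) (gr : pieces A)
    (N : nat) (f : 'I_N -> A) (K' K : tsideal A) (e : A) (X Y : seq A) : Prop := {
  lb_eK : e \in K;
  lb_eX : e \in X;
  lb_eY : e \in Y;
  lb_uX : uniq X;
  lb_uY : uniq Y;
  lb_X : forall x, x \in X -> [/\ x != 0, homogeneous gr x, x * e = x,
    e * x = (if x == e then x else 0) & forall t, f t * x = x \/ f t * x = 0];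
  lb_Y : forall y, y \in Y -> [/\ y != 0, homogeneous gr y, e * y = y,
    y * e = (if y == e then y else 0) & forall t, y * f t = y \/ y * f t = 0];
  lb_spanX : forall a, exists l : A -> k,
    a * e - \sum_(x <- X) alg_map (l x) * x \in K';
  lb_spanY : forall a, exists r : A -> k,
    e * a - \sum_(y <- Y) alg_map (r y) * y \in K';
  lb_span : forall v, v \in K -> exists c : A -> A -> k,
    v - \sum_(x <- X) \sum_(y <- Y) alg_map (c x y) * (x * y) \in K';
  lb_free : forall c : A -> A -> k,
    \sum_(x <- X) \sum_(y <- Y) alg_map (c x y) * (x * y) \in K' ->
    forall x y, x \in X -> y \in Y -> c x y = 0
}.

Section Layer.
Variables (k : comNzRingType) (A : pzAlgType k) (gr : pieces A).
Hypothesis loc : nonunits_additive k.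
Hypothesis A_gr : graded_superalgebra gr.
Variables (D : seq deg) (c : deg -> A -> A).
Hypothesis cP : components gr D c.
Variables (n : nat) (a : 'I_n -> A) (al : 'I_n -> A -> k).
Hypothesis al_lin : forall i x u v, al i (alg_map x * u + v) = x * al i u + al i v.
Hypothesis alE : forall v, v = \sum_i alg_map (al i v) * a i.
Variables (N : nat) (f : 'I_N -> A).
Hypothesis f_local : forall t, local_idempotent gr (f t).
Hypothesis f_orth : forall t t', t != t' -> f t * f t' = 0.
Hypothesis f1 : \sum_t f t = 1.
Variables (K' K : tsideal A).
Hypothesis K'_hom : homogeneous_ideal gr K'.
Hypothesis K_hom : homogeneous_ideal gr K.
Hypothesis K'K : forall v, v \in K' -> v \in K.
(** [s] is a k-linear projection with kernel [L], so that [L] is a direct summand. *)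
Definition splits_ideal (L : tsideal A) (s : A -> A) : Prop :=
  [/\ forall x u v, s (alg_map x * u + v) = alg_map x * s u + s v,
      forall v, s v - v \in L & forall v, v \in L -> s v = 0].
Variables (sigma rho : A -> A).
Hypothesis sigmaP : splits_ideal K' sigma.
Hypothesis rhoP : splits_ideal K rho.
Local Notation B := (quotient K').
Local Notation grB := (quotient_pieces gr K').
Local Notation JB := (quotient_ideal K' K).
Local Notation V := (ideal_module JB).
Local Notation pi := (qproj K').
Hypothesis hered : indecomposable_split_heredity_ideal grB JB.

Lemma f_mul t t' : f t * f t' = if t == t' then f t else 0.
Proof.
by case: eqP => [<-|/eqP/f_orth//]; case: (f_local t).
Qed.

Lemma f_deg0 t : gr 0 (f t).
Proof. by case: (f_local t). Qed.

Lemma quotient_ideal_mem v : v \in K -> pi v \in JB.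
Proof. by move=> vK; apply/asboolP; exists v. Qed.

Lemma quotient_ideal_lift v : pi v \in JB -> v \in K.
Proof.
move=> /asboolP[w wK /esym/qprojP vw].
by rewrite -(subrK w v); apply: rpredD => //; apply: K'K.
Qed.

(** The complement [v |-> v - rho v] of the splitting maps a generating family of
    [A] to one of [K]. *)
Lemma layer_generators : exists m (p : 'I_m -> V),
  (forall i, homogeneous (ideal_pieces grB JB) (p i)) /\
  forall v, exists b : 'I_m -> B, v = \sum_i b i *: p i.
Proof.
have [rhol rhoK rho0] := rhoP.
pose T := ('I_n * 'I_(size D))%type.
pose q (t : T) := c D`_t.2 (a t.1 - rho (a t.1)).
have qK t : q t \in K.
  apply: (ideal_comp cP K_hom); rewrite -opprB rpredN; exact: rhoK.
pose p t : V := ideal_elt (quotient_ideal_mem (qK t)).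
exists #|{: T}|, (fun i => p (enum_val i)); split.
  move=> i; exists D`_(enum_val i).2; rewrite /ideal_pieces ideal_eltK.
  by exists (q (enum_val i)) => //; apply: (comp_in cP).
move=> v; have /asboolP[w wK wv] := ideal_valP v.
exists (fun i => alg_map (al (enum_val i : T).1 w)); apply: val_inj.
rewrite ideal_val_sum -wv.
pose F (t : T) : B := alg_map (al t.1 w) * val (p t).
transitivity (\sum_(t : T) F t); last first.
  rewrite (reindex (fun i : 'I_#|{: T}| => enum_val i)) /=; last first.
    exact: onW_bij (@enum_val_bij T).
  by apply: eq_bigr.
have rho00 : rho 0 = 0 by rewrite rho0 ?rpred0.
have rhoD : {morph rho : u v / u + v}.
  by move=> u u'; have := rhol 1 u u'; rewrite rmorph1 !mul1r.
have rhoZ x u : rho (alg_map x * u) = alg_map x * rho u.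
  by have := rhol x u 0; rewrite rho00 !addr0.
have -> : w = \sum_l alg_map (al l w) * (a l - rho (a l)).
  have -> : \sum_l alg_map (al l w) * (a l - rho (a l)) = w - rho w.
    rewrite [in RHS](alE w) (morph_sum rho00 rhoD) -sumrB.
    by apply: eq_bigr => l _; rewrite rhoZ mulrBr.
  by rewrite rho0 ?subr0.
rewrite qproj_sum -(pair_bigA _ (fun l j => F (l, j))) /=.
apply: eq_bigr => l _; rewrite /F /= -mulr_sumr qproj_mul; congr (_ * _).
rewrite [in LHS](comp_sum cP (a l - _)) qproj_sum (big_nth 0) big_mkord.
by apply: eq_bigr.
Qed.

(** An idempotent of the corner of [pi (f t)] in degree zero lifts to [x]
    with [x * (f t - x)] in [K'], and one of the two factors is invertible. *)
Lemma layer_primitive t (u : B) : grB 0 u -> u * u = u ->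
  pi (f t) * u = u -> u * pi (f t) = u -> u = 0 \/ u = pi (f t).
Proof.
move=> [y y0 <-] uu fu uf.
have [ft0 ftt ft_local] := f_local t.
pose x := f t * y * f t.
have xu : pi x = pi y by rewrite /x !qproj_mul fu uf.
have fx : f t * x = x by rewrite /x !mulrA ftt.
have xf : x * f t = x by rewrite /x -!mulrA ftt.
have x0 : gr 0 x by rewrite -[0]addr0 -{1}[0]addr0; do ! apply: (grM A_gr).
clearbody x.
have [[z zE]|[z zE]] := ft_local x x0 fx xf; [right|left].
  apply/esym; rewrite -xu; apply/qprojP.
  rewrite -[f t - x](_ : z * (x - x * x) = _); last first.
    by rewrite mulrBr mulrA zE fx.
  by apply: tsidealMl; apply/qprojP; rewrite qproj_mul xu uu.
rewrite -xu; apply/qproj_eq0.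
rewrite -fx -zE -mulrA mulrBl fx; apply: tsidealMl.
by apply/qprojP; rewrite qproj_mul xu uu.
Qed.

Lemma layer_idempotent : exists t : 'I_N,
  [/\ f t \in K,
      forall b, exists x, f t * b * f t - alg_map x * f t \in K',
      forall x, alg_map x * f t \in K' -> x = 0 &
      exists m (g : 'I_m -> V -> B) (z : 'I_m -> A),
        [/\ forall l, f t * z l = z l,
            forall l v, g l v * pi (f t) = g l v,
            forall l b u v, g l (b *: u + v) = b * g l u + g l v &
            forall v, (val v : B) = \sum_l g l v * pi (z l)]].
Proof.
have B_gr := quotient_graded A_gr cP K'_hom.
have [cB cBP] := exists_components B_gr.1 (quotient_supported cP K').
have f0' t : grB 0 (pi (f t)) by exists (f t) => //; apply: f_deg0.
have ff' t : pi (f t) * pi (f t) = pi (f t) by rewrite -qproj_mul f_mul eqxx.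
have f1' : \sum_t pi (f t) = 1 by rewrite -qproj_sum f1.
have [t [fJ corner free [m [g [z [zP gf gl gE]]]]]] :=
  heredity_idempotent loc B_gr cBP hered layer_generators f0' ff' f1'
    layer_primitive.
exists t; split.
- exact: quotient_ideal_lift.
- move=> b; have [x xE] := corner (pi b); exists x; apply/qprojP.
  by rewrite !qproj_mul.
- move=> x /(qproj_eq0 K'); rewrite qproj_mul; exact: free.
exists m, g, (fun l => f t * qrepr (z l)).
have zE l : pi (f t * qrepr (z l)) = z l.
  by rewrite qproj_mul qreprK (zP l).2.
split=> //.
- by move=> l; rewrite mulrA f_mul eqxx.
- by move=> v; rewrite [LHS]gE; apply: eq_bigr => l _; rewrite zE.
Qed.

Local Notation W := (restr A^o).
Local Notation inK' := (fun v : W => (v : A) \in K').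

Lemma inK'0 : inK' 0. Proof. exact: rpred0. Qed.
Lemma inK'lin (x : k) (u v : W) : inK' u -> inK' v -> inK' (x *: u + v).
Proof. by move=> Ku Kv; apply: rpredD => //; apply: tsidealMl. Qed.

(** Both one-sided bases come from this lemma: [q t] is the projection onto the
    Peirce component [f t A e] for the left one, [e A f t] for the right one, where
    [e = f t0].  The diagonal component contributes [e] alone. *)
Lemma peirce_basis (q : 'I_N -> A -> A) t0 :
  (forall t x u v, q t (alg_map x * u + v) = alg_map x * q t u + q t v) ->
  (forall t t' v, q t (q t' v) = if t == t' then q t v else 0) ->
  (forall t d v, c d (q t v) = q t (c d v)) ->
  (forall t v, v \in K' -> q t v \in K') ->
  q t0 (f t0) = f t0 ->
  (forall b, exists x, q t0 b - alg_map x * f t0 \in K') ->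
  (forall x, alg_map x * f t0 \in K' -> x = 0) ->
  exists X : seq A, [/\ uniq X, f t0 \in X,
    forall x, x \in X -> [/\ x != 0, homogeneous gr x &
      x = f t0 \/ exists2 t, t != t0 & q t x = x],
    forall b, @in_span_mod k W inK' X (\sum_t q t b) &
    @free_mod k W inK' X].
Proof.
move=> ql qq qc qK q0 corner free; have [sigmal sigmaK sigma0] := sigmaP.
have q00 t : q t 0 = 0.
  by have := ql t 1 0 0; rewrite rmorph1 !mul1r addr0 -[LHS]addr0 => /addrI <-.
pose T := ('I_N * 'I_(size D))%type.
pose p (i : T) (v : W) : W := if i.1 == t0 then 0 else q i.1 (c D`_i.2 v).
have pl i : linear (p i).
  move=> x u v; rewrite /p; case: eqP => _; first by rewrite scaler0 addr0.
  by rewrite (compD cP) (comp_alg A_gr cP) ql.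
have pp i j v : p i (p j v) = if i == j then p i v else 0.
  case: i j => [t d] [t' d'] /=; rewrite /p /= xpair_eqE.
  have [->|tt0] := eqVneq t t0; first by case: ifP.
  have [->|t't0] := eqVneq t' t0.
    by rewrite (negPf tt0) (comp0 cP) q00.
  rewrite qc qq; case: eqP => _ //=.
  rewrite (comp_homogeneous cP _ (comp_in cP _ _)).
  rewrite (nth_uniq _ _ _ (comp_uniq cP)) // -val_eqE /=.
  by case: eqP => [->|].
have pK i v : inK' v -> inK' (p i v).
  move=> Kv; rewrite /p; case: eqP => _; first exact: inK'0.
  by apply: qK; apply: (ideal_comp cP K'_hom).
have [s [us sP sps fs]] := exists_graded_basis_mod (W := W) (a := a) inK'0 inK'lin
  loc al_lin alE sigmal sigmaK sigma0 pl pp pK.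
have {}sP x : x \in s -> q t0 x = 0 /\ (x != 0 -> homogeneous gr x /\
    exists2 t, t != t0 & q t x = x).
  move=> /sP[[t d] <-]; rewrite /p /=; have [_|tt0] := eqVneq t t0.
    by rewrite q00 eqxx.
  split; first by rewrite qq eq_sym (negPf tt0).
  split; last by exists t; rewrite // qq eqxx.
  by exists D`_d; rewrite -qc; apply: (comp_in cP).
have fs0 x : x \in s -> q t0 x = 0 by case/sP.
have [es fes] := free_mod_cons (W := W) (K := inK') (pi := q t0) inK'0 (ql t0)
  (qK t0) q0 fs0 free fs.
have ues : uniq (f t0 :: s) by rewrite /= es.
have nz x : x \in f t0 :: s -> x != 0.
  exact: (free_mod_nz (K := inK') inK'0 ues fes).
exists (f t0 :: s); split=> //.
- by rewrite mem_head.
- move=> x xs; have := nz x xs.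
  move: xs; rewrite inE => /predU1P[->|xs] x0.
    by split=> //; [exists 0; apply: f_deg0|left].
  by have [_ /(_ x0)[]] := sP x xs; split=> //; right.
move=> b; have [x Kx] := corner b.
pose v := \sum_i p i b.
have pv : \sum_i p i v = v.
  apply: eq_bigr => i _.
  have p0 : p i 0 = 0.
    by apply: (addrI (p i 0)); rewrite -{1}[p i 0]scale1r -pl scaler0 !addr0.
  have pD : {morph p i : u v / u + v}.
    by move=> u u'; rewrite -[u]scale1r pl !scale1r.
  rewrite /v (morph_sum p0 pD) (bigD1 i) //= pp eqxx big1 ?addr0 // => j ji.
  by rewrite pp eq_sym (negPf ji).
have bE : \sum_t q t b = q t0 b + v.
  rewrite (bigD1 t0) //=; congr (_ + _).
  rewrite /v -(pair_bigA _ (fun t d => p (t, d) b)) /= [LHS]big_mkcond /=.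
  apply: eq_bigr => t _; rewrite /p /=; case: eqP => _ /=; first by rewrite big1.
  have qD : {morph q t : u v / u + v}.
    by move=> u u'; have := ql t 1 u u'; rewrite rmorph1 !mul1r.
  rewrite [in LHS](comp_sum cP b) (morph_sum (q00 t) qD).
  by rewrite [in LHS](big_nth 0) big_mkord.
rewrite bE -[q t0 b](subrK (alg_map x * f t0)) -addrA.
apply: (in_span_modD inK'lin); first exact: in_span_mod0.
apply: (in_span_modD inK'lin).
  apply: (in_span_modZ (W := W) inK'0 inK'lin x).
  by apply: (in_span_mod_mem inK'0) => //; rewrite mem_head.
by apply: in_span_mod_cons => //; apply: sps.
Qed.

Lemma layer_left_basis t0 :
  (forall b, exists x, f t0 * b * f t0 - alg_map x * f t0 \in K') ->
  (forall x, alg_map x * f t0 \in K' -> x = 0) ->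
  exists X : seq A, [/\ uniq X, f t0 \in X,
    forall x, x \in X -> [/\ x != 0, homogeneous gr x, x * f t0 = x,
      f t0 * x = (if x == f t0 then x else 0) & forall t, f t * x = x \/ f t * x = 0],
    forall b, @in_span_mod k W inK' X (b * f t0) &
    @free_mod k W inK' X].
Proof.
move=> corner free.
pose q t v := f t * v * f t0.
have ql t x u v : q t (alg_map x * u + v) = alg_map x * q t u + q t v.
  rewrite /q mulrDr mulrDl; congr (_ + _).
  by rewrite mulrA -alg_mapC -!mulrA.
have qq t t' v : q t (q t' v) = if t == t' then q t v else 0.
  rewrite /q !mulrA f_mul -!mulrA f_mul eqxx.
  by case: eqP => // _; rewrite mul0r.
have qc t d v : c d (q t v) = q t (c d v).
  rewrite /q -{1}[d]addr0 (compMr A_gr cP (f_deg0 _)).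
  by rewrite -{1}[d]addr0 (compMl A_gr cP (f_deg0 _)).
have qK t v : v \in K' -> q t v \in K'.
  by move=> vK; apply: tsidealMr; apply: tsidealMl.
have q0 : q t0 (f t0) = f t0.
  by rewrite /q !f_mul eqxx f_mul eqxx.
have [X [uX eX XP Xsp Xf]] := peirce_basis ql qq qc qK q0 corner free.
exists X; split=> // [x xX|b]; last first.
  by have := Xsp b; rewrite -mulr_suml -mulr_suml f1 mul1r.
have [x0 xhom xc] := XP x xX; case: xc x0 xhom => [->|[t tt0 xE]] x0 xhom.
  split=> //; rewrite ?f_mul ?eqxx //.
  by move=> t; rewrite f_mul; case: eqP => [->|_]; [left|right].
have f0x : f t0 * x = 0.
  by rewrite -xE /q !mulrA f_mul eq_sym (negPf tt0) !mul0r.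
split=> //.
- by rewrite -xE /q -!mulrA f_mul eqxx.
- rewrite f0x; case: eqP => // xf; move: f0x.
  by rewrite xf f_mul eqxx => /esym.
- move=> t'; rewrite -xE /q !mulrA f_mul; case: eqP => [->|_]; first by left.
  by right; rewrite !mul0r.
Qed.

Lemma layer_right_basis t0 :
  (forall b, exists x, f t0 * b * f t0 - alg_map x * f t0 \in K') ->
  (forall x, alg_map x * f t0 \in K' -> x = 0) ->
  exists Y : seq A, [/\ uniq Y, f t0 \in Y,
    forall y, y \in Y -> [/\ y != 0, homogeneous gr y, f t0 * y = y,
      y * f t0 = (if y == f t0 then y else 0) & forall t, y * f t = y \/ y * f t = 0],
    forall b, @in_span_mod k W inK' Y (f t0 * b) &
    @free_mod k W inK' Y].
Proof.
move=> corner free.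
pose q t v := f t0 * v * f t.
have ql t x u v : q t (alg_map x * u + v) = alg_map x * q t u + q t v.
  rewrite /q mulrDr mulrDl; congr (_ + _).
  by rewrite mulrA -alg_mapC -!mulrA.
have qq t t' v : q t (q t' v) = if t == t' then q t v else 0.
  rewrite /q !mulrA f_mul eqxx -!mulrA f_mul eq_sym.
  by case: eqP => [->//|_]; rewrite !mulr0.
have qc t d v : c d (q t v) = q t (c d v).
  rewrite /q -{1}[d]addr0 (compMr A_gr cP (f_deg0 _)).
  by rewrite -{1}[d]addr0 (compMl A_gr cP (f_deg0 _)).
have qK t v : v \in K' -> q t v \in K'.
  by move=> vK; apply: tsidealMr; apply: tsidealMl.
have q0 : q t0 (f t0) = f t0.
  by rewrite /q !f_mul eqxx f_mul eqxx.
have [Y [uY eY YP Ysp Yf]] := peirce_basis ql qq qc qK q0 corner free.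
exists Y; split=> // [y yY|b]; last first.
  by have := Ysp b; rewrite -mulr_sumr f1 mulr1.
have [y0 yhom yc] := YP y yY; case: yc y0 yhom => [->|[t tt0 yE]] y0 yhom.
  split=> //; rewrite ?f_mul ?eqxx //.
  by move=> t; rewrite f_mul; case: eqP => [->|_]; [left|right].
have yf0 : y * f t0 = 0.
  by rewrite -yE /q -!mulrA f_mul (negPf tt0) !mulr0.
split=> //.
- by rewrite -yE /q !mulrA f_mul eqxx.
- rewrite yf0; case: eqP => // yf; move: yf0.
  by rewrite yf f_mul eqxx => /esym.
- move=> t'; rewrite -yE /q -!mulrA f_mul; case: eqP => [->|_]; first by left.
  by right; rewrite !mulr0.
Qed.

(** The multiplication map from [A e] tensor [e A] to the layer is onto because
    the layer is generated by [e].  It is injective because the coordinates [g l]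
    of the projective module [J] are left linear: they turn a relation between the
    [w y * y] into relations between the [w y] with coefficients in the corner
    [e A e = k e]. *)
Lemma exists_layer_basis : exists t (X Y : seq A), layer_basis gr f K' K (f t) X Y.
Proof.
have [t [eK corner free [m [g [z [ez ge gl gE]]]]]] := layer_idempotent.
have [X [uX eX XP Xsp Xf]] := layer_left_basis corner free.
have [Y [uY eY YP Ysp Yf]] := layer_right_basis corner free.
have gD l : {morph g l : u v / u + v}.
  by move=> u v; have := gl l 1 u v; rewrite scale1r mul1r.
have g0 l : g l 0 = 0 by apply: (addrI (g l 0)); rewrite -gD !addr0.
have gZ l b u : g l (b *: u) = b * g l u by rewrite -[b *: u]addr0 gl g0 addr0.
have lamP l : exists r : A -> k, z l - \sum_(y <- Y) alg_map (r y) * y \in K'.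
  by have := Ysp (z l); rewrite ez.
pose lam l := sval (cid (lamP l)).
have lamE l : pi (z l) = \sum_(y <- Y) pi (alg_map (lam l y)) * pi y.
  transitivity (pi (\sum_(y <- Y) alg_map (lam l y) * y)).
    by apply/qprojP; rewrite /lam; case: cid.
  by rewrite qproj_sum; apply: eq_bigr => y _; rewrite qproj_mul.
exists t, X, Y; split=> //.
- move=> v vK; pose vV : V := ideal_elt (quotient_ideal_mem vK).
  have muP l : exists r : A -> k,
      g l vV = \sum_(x <- X) pi (alg_map (r x)) * pi x.
    have [r rE] := Xsp (qrepr (g l vV)); exists r.
    rewrite -ge -[g l vV in LHS]qreprK -qproj_mul.
    transitivity (pi (\sum_(x <- X) alg_map (r x) * x)); first exact/qprojP.
    by rewrite qproj_sum; apply: eq_bigr => x _; rewrite qproj_mul.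
  pose mu l := sval (cid (muP l)).
  have muE l : g l vV = \sum_(x <- X) pi (alg_map (mu l x)) * pi x.
    by rewrite /mu; case: cid.
  exists (fun x y => \sum_l mu l x * lam l y); apply/qprojP.
  have -> : pi v = \sum_l g l vV * pi (z l) := gE vV.
  rewrite qproj_sum.
  under [RHS]eq_bigr => x _ do rewrite qproj_sum.
  under [LHS]eq_bigr => l _ do rewrite muE lamE mulr_suml.
  rewrite exchange_big /=; apply: eq_bigr => x _.
  under eq_bigr => l _ do rewrite mulr_sumr.
  rewrite exchange_big /=; apply: eq_bigr => y _.
  rewrite rmorph_sum mulr_suml qproj_sum; apply: eq_bigr => l _.
  rewrite rmorphM -!qproj_mul; congr (pi _).
  by rewrite -!mulrA; congr (_ * _); rewrite !mulrA alg_mapC.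
move=> d d0 x y xX yY.
pose w y := \sum_(x <- X) alg_map (d x y) * x.
have we y' : w y' * f t = w y'.
  rewrite /w mulr_suml big_seq [RHS]big_seq; apply: eq_bigr => x' x'X.
  by rewrite -mulrA; case: (XP x' x'X) => _ _ -> _ _.
have yK y' : f t * y' \in K by apply: tsidealMr.
pose phi y' : V := ideal_elt (quotient_ideal_mem (yK y')).
have phiZ y' : phi y' = pi (f t) *: phi y'.
  apply: val_inj; rewrite ideal_valZ ideal_eltK -qproj_mul mulrA f_mul eqxx.
  by [].
have gamP l y' : exists x, g l (phi y') = pi (alg_map x * f t).
  have [x' x'E] := corner (qrepr (g l (phi y'))); exists x'.
  by rewrite phiZ gZ -ge -[g l _]qreprK -!qproj_mul mulrA; apply/qprojP.
pose gam l y' := sval (cid (gamP l y')).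
have gamE l y' : g l (phi y') = pi (alg_map (gam l y') * f t).
  by rewrite /gam; case: cid.
have yphi y' : y' \in Y -> val (phi y') = pi y'.
  by move=> y'Y; rewrite ideal_eltK; case: (YP y' y'Y) => _ _ -> _ _.
(* [gam] and [lam] are dual: this expresses [y1] through the dual basis of [J]. *)
have delta y1 y2 : y1 \in Y -> y2 \in Y ->
    (y1 == y2)%:R = \sum_l gam l y1 * lam l y2.
  move=> y1Y y2Y; apply/eqP; rewrite -subr_eq0; apply/eqP.
  apply: (Yf (fun y2 => (y1 == y2)%:R - \sum_l gam l y1 * lam l y2)) => //.
  under eq_bigr => y' _ do rewrite scalerBl.
  rewrite sumrB sum_delta //; apply/qprojP.
  transitivity (pi (\sum_l alg_map (gam l y1) *
      \sum_(y <- Y) alg_map (lam l y) * y)).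
    rewrite qproj_sum -(yphi y1 y1Y) [LHS]gE; apply: eq_bigr => l _.
    rewrite gamE -qproj_mul -mulrA ez qproj_mul [RHS]qproj_mul.
    by congr (_ * _); apply/qprojP; rewrite /lam; case: cid.
  congr (pi _).
  transitivity (\sum_(y <- Y) alg_map (\sum_l gam l y1 * lam l y) * y);
    last by [].
  under eq_bigr => l _ do rewrite mulr_sumr.
  transitivity (\sum_(y <- Y) \sum_l alg_map (gam l y1) * (alg_map (lam l y) * y)).
    exact: exchange_big.
  apply: eq_bigr => y' _.
  transitivity (\sum_l alg_map (gam l y1 * lam l y') * y'); last first.
    by rewrite rmorph_sum mulr_suml.
  by apply: eq_bigr => l _; rewrite rmorphM mulrA.
have wrel l : \sum_(y' <- Y) alg_map (gam l y') * w y' \in K'.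
  apply/(qproj_eq0 K').
  have sum0 : \sum_(y' <- Y) pi (w y') *: phi y' = 0.
    have wphi y' : y' \in Y -> val (pi (w y') *: phi y') = pi (w y' * y').
      by move=> y'Y; rewrite qproj_mul -(yphi y' y'Y).
    apply: val_inj; rewrite ideal_val_sum (eq_big_seq _ wphi).
    transitivity (pi (\sum_(y' <- Y) w y' * y')); first by rewrite qproj_sum.
    apply/(qproj_eq0 K'); rewrite exchange_big /= in d0.
    rewrite (eq_bigr (fun y' => \sum_(x <- X) alg_map (d x y') * (x * y'))) //.
    by move=> y' _; rewrite mulr_suml; apply: eq_bigr => x' _; rewrite mulrA.
  have := congr1 (g l) sum0; rewrite (morph_sum (g0 l) (gD l)) g0 => <-.
  rewrite qproj_sum; apply: eq_bigr => y' _; rewrite gZ gamE -qproj_mul.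
  by rewrite [w y' * _]mulrA -alg_mapC -mulrA we.
apply: (Xf (fun x => d x y)) => //.
rewrite -[X in X \in K'](_ : \sum_l alg_map (lam l y) *
    (\sum_(y' <- Y) alg_map (gam l y') * w y') = _).
  by apply: rpred_sum => l _; apply: tsidealMl; apply: wrel.
transitivity (\sum_(y' <- Y) alg_map ((y' == y)%:R) * w y'); last first.
  rewrite (sum_only (i := y)) ?eqxx ?rmorph1 ?mul1r ?yY //.
  by move=> y' /negPf ->; rewrite rmorph0 mul0r.
under eq_bigr => l _ do rewrite mulr_sumr.
rewrite exchange_big /= big_seq [RHS]big_seq; apply: eq_bigr => y' y'Y.
rewrite delta // rmorph_sum mulr_suml; apply: eq_bigr => l _.
by rewrite mulrA -rmorphM mulrC.
Qed.
End Layer.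

(** * Heredity chains *)

Lemma exists_minimal_element d (I : finPOrderType d) (O : {set I}) (x0 : I) :
  x0 \in O -> exists2 x, x \in O & forall y, y \in O -> (y <= x)%O -> y = x.
Proof.
move=> x0O; pose h x := #|[set y : I | (y <= x)%O]|.
case: (arg_minnP h x0O) => x xO xmin; exists x => // y yO yx; apply/eqP.
apply: contraTT (xmin y yO) => nyx; rewrite -ltnNge; apply: proper_card.
apply/properP; split.
  by apply/subsetP => z; rewrite !inE => zy; apply: Order.POrderTheory.le_trans zy yx.
exists x; rewrite !inE ?Order.POrderTheory.lexx //.
by apply: contraNN nyx => xy; rewrite Order.POrderTheory.eq_le yx.
Qed.

(** Minimal elements are removed one at a time. *)
Lemma upper_set_chain d (I : finPOrderType d) m (O : {set I}) :
  upper_set O -> #|O| = m ->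
  exists U : nat -> {set I},
    [/\ U 0%N = O, U m = set0, forall r, upper_set (U r),
        forall r, U r.+1 \subset U r &
        forall r, (r < m)%N -> #|U r :\: U r.+1| = 1%N].
Proof.
elim: m O => [|m IHm] O upO cardO.
  exists (fun=> O); split=> //; exact: cards0_eq.
have [x0 x0O] : exists x, x \in O by apply/card_gt0P; rewrite cardO.
have [x xO xmin] := exists_minimal_element x0O.
have upO' : upper_set (O :\ x).
  move=> i j; rewrite !inE => /andP[ix iO] ij; rewrite (upO i j) // andbT.
  by apply: contraNneq ix => jx; apply/eqP/xmin; rewrite -?jx.
have [|U [U0 Um upU subU stepU]] := IHm (O :\ x) upO'.
  by move: cardO; rewrite (cardsD1 x) xO => -[].
exists (fun r => if r is r'.+1 then U r' else O); split=> //.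
- by case.
- by case=> [|r]; rewrite ?U0 ?subD1set.
case=> [_|r]; last exact: stepU.
rewrite U0 (_ : O :\: (O :\ x) = [set x]) ?cards1 //.
by apply/setP => y; rewrite !inE; have [->|] := eqVneq y x; rewrite ?xO // andNb.
Qed.

(** The order of the poset is forgotten here; only a linear refinement of it is
    kept. *)
Lemma heredity_chain (k : comNzRingType) (A : pzAlgType k) (gr : pieces A) :
  split_quasi_hereditary gr ->
  exists n (K : nat -> tsideal A),
    [/\ forall a, a \in K 0%N, forall a, a \in K n -> a = 0,
        forall r, homogeneous_ideal gr (K r),
        forall r a, a \in K r.+1 -> a \in K r &
        forall r, (r < n)%N -> indecomposable_split_heredity_ideal
          (quotient_pieces gr (K r.+1)) (quotient_ideal (K r.+1) (K r))].
Proof.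
case=> d [I [J [Jhom J0 J1 Jsub Jhered]]].
have upT : upper_set [set: I] by move=> i j _ _; rewrite inE.
have [U [U0 Um upU subU stepU]] := upper_set_chain upT erefl.
exists #|[set: I]|, (fun r => J (U r)); split.
- by move=> a; rewrite U0.
- by move=> a; rewrite Um J0 => /eqP.
- by move=> r; apply: Jhom.
- by move=> r; apply: Jsub.
- by move=> r /stepU; apply: Jhered.
Qed.

(** * Assembling the layers *)

Section Assembly.
Variables (k : comNzRingType) (A : pzAlgType k) (gr : pieces A).
Variables (N : nat) (f : 'I_N -> A).
Hypothesis f_orth : forall t t', t != t' -> f t * f t' = 0.
Variables (n : nat) (K : nat -> tsideal A).
Hypothesis K_first : forall a, a \in K 0%N.
Hypothesis K_last : forall a, a \in K n -> a = 0.
Hypothesis K_dec : forall r a, a \in K r.+1 -> a \in K r.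
Variables (t : 'I_n -> 'I_N) (X Y : 'I_n -> seq A).
Hypothesis XY : forall r : 'I_n, layer_basis gr f (K r.+1) (K r) (f (t r)) (X r) (Y r).

Definition layer_sum (c : 'I_n -> A -> A -> k) (r : 'I_n) : A :=
  \sum_(x <- X r) \sum_(y <- Y r) alg_map (c r x y) * (x * y).

Lemma K_le r s a : (r <= s)%N -> a \in K s -> a \in K r.
Proof.
move/subnK => <-; elim: (s - r)%N => // m IHm; rewrite addSn => /K_dec.
exact: IHm.
Qed.

Lemma layer_sum_in c r : layer_sum c r \in K r.
Proof.
rewrite /layer_sum big_seq; apply: rpred_sum => x xX.
apply: rpred_sum => y _; apply: tsidealMl; apply: tsidealMr.
have [_ _ <- _ _] := lb_X (XY r) xX; apply: tsidealMl; exact: lb_eK (XY r).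
Qed.

Lemma layer_sum_span r : (r <= n)%N -> forall v, v \in K r ->
  exists c, v = \sum_(j : 'I_n | (r <= j)%N) layer_sum c j.
Proof.
move=> /subKn <-; elim: (n - r)%N (leq_subr r n) => [_|m IHm lt_mn] v.
  rewrite subn0 => /K_last ->; exists (fun _ _ _ => 0).
  by rewrite big1 // => j; rewrite leqNgt ltn_ord.
have rn : (n - m.+1 < n)%N by rewrite ltn_subrL /= (leq_ltn_trans _ lt_mn).
have rS : (n - m.+1).+1 = (n - m)%N by rewrite -subSn // subSS.
pose i := Ordinal rn; move=> vK.
have [c0] := lb_span (XY i) (vK : v \in K i).
rewrite /= rS => /(IHm (ltnW lt_mn))[c cE].
exists (fun j => if j == i then c0 else c j).
rewrite (bigD1 i) //= {1}/layer_sum eqxx; apply/eqP.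
rewrite addrC -subr_eq cE -rS; apply/eqP; apply: eq_big => [j|j ij].
  by rewrite ltn_neqAle andbC -val_eqE /= eq_sym.
rewrite /layer_sum; case: eqP => // ji; move: ij.
by rewrite ji /= ltnn.
Qed.

(** By induction on [i]: the coefficients of the lower layers vanish and the higher
    layers lie in [K i.+1], so that a relation holds modulo [K i.+1] in layer [i]. *)
Lemma layer_sum_free c : \sum_j layer_sum c j = 0 ->
  forall i x y, x \in X i -> y \in Y i -> c i x y = 0.
Proof.
move=> c0 i; have [m] := ubnP i; elim: m i => // m IHm i; rewrite ltnS => im.
apply: (lb_free (XY i)); rewrite -/(layer_sum c i).
move: c0; rewrite (bigD1 i) //= => /eqP; rewrite addr_eq0 => /eqP ->.
rewrite rpredN; apply: rpred_sum => j ji.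
have [ij|] := ltnP i j; first exact: K_le ij (layer_sum_in c j).
rewrite leq_eqVlt val_eqE (negPf ji) /= => lt_ji.
rewrite /layer_sum big_seq big1 ?rpred0 // => x xX.
rewrite big_seq big1 // => y yY; rewrite (IHm j) ?rmorph0 ?mul0r //.
exact: leq_trans lt_ji im.
Qed.

Lemma idempotent_notin i : f (t i) \notin K i.+1.
Proof.
have fX := lb_eX (XY i); have fY := lb_eY (XY i).
have [_ _ ffE _ _] := lb_X (XY i) fX.
pose c x y : k := ((x == f (t i)) && (y == f (t i)))%:R.
have cE : \sum_(x <- X i) \sum_(y <- Y i) alg_map (c x y) * (x * y) = f (t i).
  rewrite (sum_only (i := f (t i))) ?(lb_uX (XY i)) ?fX //; last first.
    by move=> x /negPf nx; rewrite big1 // => y _; rewrite /c nx rmorph0 mul0r.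
  rewrite (sum_only (i := f (t i))) ?(lb_uY (XY i)) ?fY //; last first.
    by move=> y /negPf ny; rewrite /c ny andbF rmorph0 mul0r.
  by rewrite /c !eqxx rmorph1 mul1r ffE.
apply/negP => fK; have := lb_free (XY i) (c := c); rewrite cE.
by move=> /(_ fK _ _ fX fY)/eqP; rewrite /c !eqxx oner_eq0.
Qed.

Lemma layer_idempotent_inj : injective t.
Proof.
have lt (i j : 'I_n) : (i < j)%N -> t i <> t j.
  move=> ij tij; have /negP := idempotent_notin i; apply.
  by rewrite tij; apply: K_le ij _; apply: lb_eK (XY j).
move=> i j tij; apply: val_inj => /=; case: (ltngtP i j) => // h.
  by case: (lt _ _ h).
by case: (lt _ _ h).
Qed.

Lemma sum_fset (s : seq A) (F : A -> A) : uniq s ->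
  \sum_(x <- [fset z in s]%fset) F x = \sum_(x <- s) F x.
Proof.
move=> us; apply: perm_big; apply: uniq_perm; rewrite ?fset_uniq //.
by move=> x; rewrite inE.
Qed.

Lemma layers_heredity_data :
  heredity_data (I := 'I_n) gr (fun i => [fset z in X i]%fset)
    (fun i => [fset z in Y i]%fset) (fun i => f (t i)).
Proof.
have sumE (c : 'I_n -> A -> A -> k) (P : pred 'I_n) :
    \sum_(i | P i) \sum_(x <- [fset z in X i]%fset) \sum_(y <- [fset z in Y i]%fset)
      alg_map (c i x y) * (x * y) = \sum_(i | P i) layer_sum c i.
  apply: eq_bigr => i _; rewrite sum_fset ?(lb_uX (XY i)) //.
  by apply: eq_bigr => x _; rewrite sum_fset ?(lb_uY (XY i)).
have above (i : 'I_n) v : v \in K i.+1 ->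
    span_above (fun i => [fset z in X i]%fset) (fun i => [fset z in Y i]%fset) i v.
  move=> vK; have [c ->] := layer_sum_span (ltn_ord i) vK.
  by exists c; rewrite sumE.
split.
- by move=> i x; rewrite inE => /(lb_X (XY i))[].
- by move=> i y; rewrite inE => /(lb_Y (XY i))[].
- move=> i j x; rewrite !inE => /(lb_X (XY i))[x0 _ xi _ _] /(lb_X (XY j))[_ _ xj _ _].
  apply/eqP; apply: contraNT x0 => ij; apply/eqP.
  by rewrite -xj -xi -mulrA f_orth ?mulr0 // (inj_eq layer_idempotent_inj).
- move=> i j y; rewrite !inE => /(lb_Y (XY i))[y0 _ yi _ _] /(lb_Y (XY j))[_ _ yj _ _].
  apply/eqP; apply: contraNT y0 => ij; apply/eqP.
  by rewrite -yj -yi mulrA f_orth ?mul0r // (inj_eq layer_idempotent_inj) eq_sym.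
- by move=> i; rewrite !inE (lb_eX (XY i)) (lb_eY (XY i)).
- move=> a; have [c ->] := layer_sum_span (leq0n n) (K_first a).
  by exists c; rewrite sumE.
- move=> c; rewrite sumE => c0 i x y; rewrite !inE; exact: layer_sum_free.
- move=> i x a; rewrite inE => xX; have [l lE] := lb_spanX (XY i) (a * x).
  exists l; apply: above; rewrite sum_fset ?(lb_uX (XY i)) //.
  by have [_ _ xe _ _] := lb_X (XY i) xX; rewrite -mulrA xe in lE.
- move=> i y a; rewrite inE => yY; have [r rE] := lb_spanY (XY i) (y * a).
  exists r; apply: above; rewrite sum_fset ?(lb_uY (XY i)) //.
  by have [_ _ ey _ _] := lb_Y (XY i) yY; rewrite mulrA ey in rE.
- by move=> i x; rewrite inE => /(lb_X (XY i))[].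
- by move=> i x; rewrite inE => /(lb_X (XY i))[].
- by move=> i x; rewrite inE => /(lb_Y (XY i))[].
- by move=> i x; rewrite inE => /(lb_Y (XY i))[].
- by move=> i j x; rewrite inE => /(lb_X (XY i))[].
- by move=> i j y; rewrite inE => /(lb_Y (XY i))[].
Qed.
End Assembly.

(** [A / K r] is the quotient of [A / K r.+1] by its heredity ideal, hence projective
    over [k]. *)
Lemma heredity_chain_splits (k : comNzRingType) (A : pzAlgType k) (gr : pieces A)
    n (K : nat -> tsideal A) :
  (forall a, a \in K n -> a = 0) ->
  (forall r a, a \in K r.+1 -> a \in K r) ->
  (forall r, (r < n)%N -> indecomposable_split_heredity_ideal
          (quotient_pieces gr (K r.+1)) (quotient_ideal (K r.+1) (K r))) ->
  forall r, (r <= n)%N -> exists s : A -> A, splits_ideal (K r) s.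
Proof.
move=> K_last K_dec hered r; rewrite leq_eqVlt => /predU1P[->|rn].
  by exists id; split=> // v; rewrite subrr rpred0.
have [_ Kproj _ _ _] := hered r rn.
set J := quotient_ideal _ _ in Kproj.
pose g (v : restr A^o) : restr (quotient J)^o := qproj J (qproj (K r.+1) v).
have gl : linear g by move=> x u v; rewrite /g !qprojD qproj_mul qproj_mul.
have gsurj y : exists x, g x = y.
  by have [b <-] := qproj_surj y; have [a <-] := qproj_surj b; exists a.
have g0 v : g v = 0 <-> v \in K r.
  rewrite /g; split=> [/(qproj_eq0 J)|vK].
    by apply: quotient_ideal_lift; apply: K_dec.
  by apply/(qproj_eq0 J); apply: quotient_ideal_mem.
have [s [sl sE s0]] := projective_splits gl gsurj Kproj.
exists s; split=> // v; last by move=> /g0/s0.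
by apply/g0; rewrite /g !qprojB; apply/eqP; rewrite subr_eq0; apply/eqP/sE.
Qed.

Theorem proposition3p5 (k : comNzRingType) (A : pzAlgType k) (gr : pieces A)
    (k_noetherian : noetherian k) (k_local : local_ring k)
    (A_graded : graded_superalgebra gr)
    (A_fg : @finitely_generated k (restr A^o))
    (A_proj : @projective k (restr A^o))
    (A_semiperfect : semiperfect gr)
    (A_sqh : split_quasi_hereditary gr) :
  based_quasi_hereditary gr.
Proof.
have loc := local_nonunits_additive k_local.
have [D D_supp] := finitely_generated_supported A_graded.1 A_fg.
have [c cP] := exists_components A_graded.1 D_supp.
have [N [f [f_local f_orth f1]]] :=
  local_idempotent_decomposition A_graded cP A_semiperfect.
have [n [K [K_first K_last K_hom K_dec hered]]] := heredity_chain A_sqh.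
have splits := heredity_chain_splits K_last K_dec hered.
have [m [a gen]] := A_fg.
have [al [al_lin alE]] := projective_dual_basis A_proj gen.
have layer (r : 'I_n) : exists tXY : 'I_N * seq A * seq A,
    layer_basis gr f (K r.+1) (K r) (f tXY.1.1) tXY.1.2 tXY.2.
  have [sigma sigmaP] := splits r.+1 (ltn_ord r).
  have [rho rhoP] := splits r (ltnW (ltn_ord r)).
  have [t [X [Y XY]]] := exists_layer_basis loc A_graded cP al_lin alE f_local f_orth
    f1 (K_hom r.+1) (K_hom r) (@K_dec r) sigmaP rhoP (hered r (ltn_ord r)).
  by exists (t, X, Y).
have [tXY XY] := choice layer.
have data := layers_heredity_data (t := fun r => (tXY r).1.1)
  (X := fun r => (tXY r).1.2) (Y := fun r => (tXY r).2) f_orth K_first K_last K_dec XY.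
by do 5! eexists; exact: data.
Qed.
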